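(* Let $d\ge 1$ and let $S_N=\sum_{n=1}^N X_n$ be a random walk on $\mathbb{Z}^d$ with i.i.d. steps satisfying the non-degeneracy and aperiodicity assumptions of the context. Suppose that $\mathbb{E}(X_1)=0$ and that $S_N$ is in the normal domain of attraction of a stable law of some index $\alpha>1$. Then for every $F\in \mathbf{G}_0$, with $T_N=\sum_{n=1}^N F(S_n)$, $$\frac{T_N}{N}\Rightarrow \bar F\quad\text{in law as } N\to\infty .$$
   Context: $X_1,X_2,\dots$ are i.i.d. $\mathbb{Z}^d$-valued random variables, $S_0=0$, $S_N=\sum_{n=1}^N X_n$. Standing assumptions: (non-degeneracy) the smallest group supporting the range of $X_1$ is $\mathbb{Z}^d$; (aperiodicity) $\gcd\{n>0:\mathbb{P}(S_n=0)>0\}=1$. $S_n$ is in the normal domain of attraction of a stable law of index $\alpha\in(1,2]$ if there is a non-degenerate $d$-dimensional random variable $Y$ (i.e. not supported in a proper affine subspace), with $\alpha$-stable law, such that $\frac{S_n-n\mathbb{E}(X_1)}{n^{1/\alpha}}\Rightarrow Y$ in law. For a non-empty finite $V\subset\mathbb{Z}^d$ and a bounded $F:\mathbb{Z}^d\to\mathbb{R}$, $\bar F_V=\frac1{|V|}\sum_{v\in V}F(v)$. For real $a_j<b_j$, $V(a_1,b_1,\dots,a_d,b_d)=\{x\in\mathbb{Z}^d: x_j\in[a_j,b_j],\ j=1,\dots,d\}$. $\mathbf{G}_0$ is the set of bounded $F:\mathbb{Z}^d\to\mathbb{R}$ for which there is a number $\bar F$ such that for all $a_1<b_1,\dots,a_d<b_d$,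 $\lim_{L\to\infty}\bar F_{V(a_1L,b_1L,\dots,a_dL,b_dL)}=\bar F$. *)

(* Defs.v *)
From HB Require Import structures.
From mathcomp Require Import all_boot all_order all_algebra finmap.
From mathcomp Require Import all_classical all_reals all_analysis.

Set Implicit Arguments.
Unset Strict Implicit.
Unset Printing Implicit Defensive.

Import Order.TTheory GRing.Theory Num.Theory.
Import numFieldNormedType.Exports.

Local Open Scope classical_set_scope.
Local Open Scope ring_scope.

Notation borel V := (g_sigma_algebraType (@open V)).

Section convergence_in_law.
Context {R : realType} {disp : measure_display} {Omega : measurableType disp}.
Variable P : probability Omega R.

Definition cvg_in_law (V : ptopologicalType) (Z : nat -> Omega -> V)
    (mu : probability (borel V) R) : Prop :=
  forall f : V -> R, continuous f -> (exists M, forall y, `|f y| <= M) ->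
    ('E_P[fun w => f (Z n w)] @[n --> \oo] --> \int[mu]_y (f y)%:E)%E.

End convergence_in_law.

Section stable_laws.
Context {R : realType} {d : nat}.
Implicit Types mu : probability (borel 'rV[R]_d) R.

(* With Y, Y1, Y2 independent of law mu:
   a Y1 + b Y2 has the law of (a^alpha + b^alpha)^(1/alpha) Y + c. *)
Definition stable_law (alpha : R) mu : Prop :=
  forall a b : R, 0 < a -> 0 < b -> exists c : 'rV[R]_d,
    forall B : set (borel 'rV[R]_d), measurable B ->
      (mu \x mu)%E [set y | B (a *: (y.1 : 'rV[R]_d) + b *: (y.2 : 'rV[R]_d))] =
      mu [set y | B ((a `^ alpha + b `^ alpha) `^ alpha^-1 *: (y : 'rV[R]_d) + c)].

(* The affine subspaces of R^d are the p + U with U a linear subspace. *)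
Definition nondegenerate_law mu : Prop :=
  forall (p : 'rV[R]_d) (U : {vspace 'rV[R]_d}), U != fullv ->
    mu [set y | (y : 'rV[R]_d) - p \in U] <> 1%E.

End stable_laws.

Section random_walk.
Context {R : realType} {disp : measure_display} {Omega : measurableType disp}.
Variable P : probability Omega R.
Context {d : nat}.
(* The steps are indexed from 0: X n stands for X_(n+1). *)
Variable X : nat -> Omega -> 'rV[int]_d.

(* Z^d carries the discrete sigma-algebra. *)
Definition iid : Prop :=
  [/\ forall n (A : set 'rV[int]_d), measurable (X n @^-1` A),
      forall (J : {fset nat}) (A : nat -> set 'rV[int]_d),
        P (\bigcap_(j in [set` J]) (X j @^-1` A j)) =
        (\prod_(j <- J) P (X j @^-1` A j))%E &
      forall n (A : set 'rV[int]_d), P (X n @^-1` A) = P (X 0%N @^-1` A)].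

Definition walk (n : nat) (w : Omega) : 'rV[int]_d := \sum_(i < n) X i w.

Definition nondegenerate_walk : Prop :=
  forall H : {pred 'rV[int]_d}, zmod_closed H ->
    P [set w | X 0%N w \in H] = 1%E -> forall x, x \in H.

Definition return_times : set nat :=
  [set n | (0 < n)%N /\ (0 < P [set w | walk n w = 0%R])%E].

Definition is_gcd (A : set nat) (g : nat) : Prop :=
  (forall n, A n -> (g %| n)%N) /\
  (forall h, (forall n, A n -> (h %| n)%N) -> (h %| g)%N).

Definition aperiodic_walk : Prop := is_gcd return_times 1.

Definition toR (x : 'rV[int]_d) : 'rV[R]_d := map_mx (fun z : int => z%:~R) x.

Definition integrable_step : Prop :=
  forall j, P.-integrable setT (fun w => (toR (X 0%N w) 0 j)%:E).

Definition mean_step : 'rV[R]_d :=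
  \row_j fine ('E_P[fun w => toR (X 0%N w) 0%R j])%E.

Definition in_normal_domain_of_attraction (alpha : R) : Prop :=
  exists mu : probability (borel 'rV[R]_d) R,
    [/\ nondegenerate_law mu, stable_law alpha mu &
        cvg_in_law P
          (fun n w => (n%:R `^ alpha^-1)^-1 *: (toR (walk n w) - n%:R *: mean_step))
          mu].

End random_walk.

Section global_observables.
Context {R : realType} {d : nat}.
Implicit Types F : 'rV[int]_d -> R.

Definition average F (V : {fset 'rV[int]_d}) : R :=
  (#|` V|%:R)^-1 * \sum_(v <- V) F v.

Definition box_set (a b : 'I_d -> R) : set 'rV[int]_d :=
  [set x | forall j, a j <= (x 0 j)%:~R <= b j].

Definition box (a b : 'I_d -> R) : {fset 'rV[int]_d} := fset_set (box_set a b).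

(* box a b has the same elements as box_set a b, by finiteness. *)
Lemma finite_box_set (a b : 'I_d -> R) : finite_set (box_set a b).
Proof.
pose K := (\sum_j (Num.truncn `|a j| + Num.truncn `|b j|).+1)%N.
have hK j : `|a j| <= K%:R /\ `|b j| <= K%:R.
  have hj : ((Num.truncn `|a j| + Num.truncn `|b j|).+1 <= K)%N.
    by rewrite /K (bigD1 j) //= leq_addr.
  split; apply/ltW/(lt_le_trans (truncnS_gt _)); rewrite ler_nat;
    apply: leq_trans hj; rewrite ltnS ?leq_addr ?leq_addl //.
pose f (y : 'rV['I_(K + K).+1]_d) : 'rV[int]_d :=
  \row_j ((y 0 j : nat)%:Z - K%:Z).
apply: (@sub_finite_set _ _ (f @` setT)); last first.
  by apply: finite_image; exact: finite_finset.
move=> x hx.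
have hxj j : (0 <= x 0 j + K%:Z) /\ (x 0 j + K%:Z <= (K + K)%N%:Z).
  have /andP[h1 h2] := hx j; have [ha hb] := hK j.
  split.
    rewrite -(ler_int R) rmorphD /= -lerBlDr sub0r.
    by apply: le_trans h1; rewrite lerNl (le_trans _ ha) // -normrN ler_norm.
  rewrite PoszD lerD2r -(ler_int R).
  by apply: (le_trans h2); apply: le_trans hb; exact: ler_norm.
exists (\row_j inord (absz (x 0 j + K%:Z))) => //.
apply/rowP => j; rewrite !mxE; have [h1 h2] := hxj j.
by rewrite inordK ?gez0_abs ?addrK // ltnS -lez_nat gez0_abs.
Qed.

Definition global_average F (Fbar : R) : Prop :=
  forall a b : 'I_d -> R, (forall j, a j < b j) ->
    average F (box (fun j => a j * L) (fun j => b j * L)) @[L --> +oo] --> Fbar.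

Definition G0 : set ('rV[int]_d -> R) :=
  [set F | (exists M, forall x, `|F x| <= M) /\
           exists Fbar, global_average F Fbar].

End global_observables.

(* Main.v *)
Require Import Defs.
From HB Require Import structures.
From mathcomp Require Import all_boot all_order all_algebra finmap.
From mathcomp Require Import all_classical all_reals all_analysis.
From mathcomp Require Import measurable_realfun ring lra zify.

Set Implicit Arguments.
Unset Strict Implicit.
Unset Printing Implicit Defensive.

Import Order.TTheory GRing.Theory Num.Theory.
Import numFieldNormedType.Exports.

Local Open Scope classical_set_scope.
Local Open Scope ring_scope.

(** Write G = F - Fbar. It suffices that E[(G(S_1) + ... + G(S_N))^2] = o(N^2), hence
    that E[G(S_n) G(S_(n+k))] is small when k >= eps N. Restricted to a box of odd side
    M of order N^(1/alpha), which contains S_(n+k) with probability close to 1, G is a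
    combination of the waves cos(theta.x), sin(theta.x), theta in (2 pi / M) Z^d, and
    independence of the steps bounds the contribution of theta by its coefficient
    times |phi(theta)|^k, phi being the characteristic function of a step.
    - Convergence to a non-degenerate stable law near 0, and aperiodicity away from 0,
      give |phi(theta)|^2 <= exp(-c |theta|^alpha) for |theta| <= pi, so that the sum
      over theta converges uniformly in N.
    - Each coefficient tends to 0: a wave of given frequency is nearly constant on the
      cells of a fine subdivision of the box, and G has small averages on these cells.
    No local limit theorem is needed. Complex numbers are avoided: the squared modulus
    of an expectation of exp(i f) is (E cos f)^2 + (E sin f)^2. *)

(** * Expectations of bounded functions *)

(** Only the later factor G(S_(n+k)) is expanded into waves; G(S_n) stays inside the expectation as
    a bounded factor, so nothing has to be known about the distribution at time n. For k >= eps N,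
    the wave of integer index xi gets a weight at most exp(- kappa |xi|_1), with kappa independent
    of N: as M is of order N^(1/alpha), the factor 1/N contained in |theta|^alpha cancels against k.
    The number Q^d of cells can therefore be fixed before N. The error pi |xi|_1 / Q of freezing a
    wave on each cell is summable against the weight, and for fixed Q the cell averages of G tend to
    0. This also covers frequency 0, where there is no decay: its coefficient is the mean of G over
    the box. The decay near 0 does not come from an expansion of phi: for n about |theta|^(-alpha),
    the point n^(1/alpha) theta lies in a fixed annulus, on which the modulus for the limit law
    stays away from 1. *)

Section bounded_measurable.
Context {R : realType} {disp : measure_display} {T : measurableType disp}.
Implicit Types f g : T -> R.

(** Stable under ring operations and integrable for every probability: integrands of this class let
    the proof work with the real-valued integral. *)
Definition bmf f := measurable_fun setT f /\ exists M, forall w, `|f w| <= M.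

Lemma bmf_cst (c : R) : bmf (fun=> c).
Proof. by split; [exact: measurable_cst | exists `|c|]. Qed.

Lemma bmfD f g : bmf f -> bmf g -> bmf (fun w => f w + g w).
Proof.
move=> [mf [M hM]] [mg [N hN]]; split; first exact: measurable_funD.
by exists (M + N) => w; rewrite (le_trans (ler_normD _ _))// lerD.
Qed.

Lemma bmfM f g : bmf f -> bmf g -> bmf (fun w => f w * g w).
Proof.
move=> [mf [M hM]] [mg [N hN]]; split; first exact: measurable_funM.
by exists (M * N) => w; rewrite normrM ler_pM.
Qed.

Lemma bmfZ (c : R) f : bmf f -> bmf (fun w => c * f w).
Proof. exact/bmfM/bmf_cst. Qed.

Lemma bmfN f : bmf f -> bmf (fun w => - f w).
Proof.
by move=> /(bmfZ (-1)); congr bmf; apply/funext => w; rewrite mulN1r.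
Qed.

Lemma bmfB f g : bmf f -> bmf g -> bmf (fun w => f w - g w).
Proof. by move=> bf bg; apply: bmfD => //; exact: bmfN. Qed.

Lemma bmfX f n : bmf f -> bmf (fun w => f w ^+ n).
Proof.
move=> bf; elim: n => [|n ih].
  by rewrite (_ : (fun w => _) = fun=> 1); [exact: bmf_cst|apply/funext => w; rewrite expr0].
rewrite (_ : (fun w => _) = fun w => f w * f w ^+ n); first exact: bmfM.
by apply/funext => w; rewrite exprS.
Qed.

Lemma bmf_sum (I : Type) (r : seq I) (Q : pred I) (f : I -> T -> R) :
  (forall i, bmf (f i)) -> bmf (fun w => \sum_(i <- r | Q i) f i w).
Proof.
move=> bf; elim: r => [|i r ih].
  rewrite (_ : (fun w => _) = fun=> 0); first exact: bmf_cst.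
  by apply/funext => w; rewrite big_nil.
rewrite (_ : (fun w => _) = fun w => (if Q i then f i w else 0) + \sum_(i <- r | Q i) f i w).
  by apply: bmfD => //; case: (Q i); [exact: bf | exact: bmf_cst].
by apply/funext => w; rewrite big_cons; case: ifP => // _; rewrite add0r.
Qed.

Lemma bmf_cos f : measurable_fun setT f -> bmf (fun w => cos (f w)).
Proof.
move=> mf; split; last first.
  by exists 1 => w; rewrite ler_norml cos_geN1 cos_le1.
apply: measurableT_comp => //; apply: continuous_measurable_fun.
exact: continuous_cos.
Qed.

Lemma bmf_sin f : measurable_fun setT f -> bmf (fun w => sin (f w)).
Proof.
move=> mf; split; last first.
  by exists 1 => w; rewrite ler_norml sin_geN1 sin_le1.
apply: measurableT_comp => //; apply: continuous_measurable_fun.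
exact: continuous_sin.
Qed.

Variable P : probability T R.

Local Notation mean f := (\int[P]_w f w).

Lemma bmf_integrable f : bmf f -> P.-integrable setT (EFin \o f).
Proof.
move=> [mf [M hM]]; apply: measurable_bounded_integrable => //.
  by apply: (le_lt_trans (probability_le1 P _)) => //; exact: ltry.
exists M; split; first exact: num_real.
by move=> x Mx w _ /=; rewrite (le_trans (hM w))// ltW.
Qed.

Lemma bmf_expectation f : bmf f -> 'E_P[f]%E = (mean f)%:E.
Proof.
move=> bf; rewrite unlock /Rintegral fineK//.
exact/integrable_fin_num/bmf_integrable.
Qed.

Lemma meanD f g : bmf f -> bmf g ->
  \int[P]_w (f w + g w) = mean f + mean g.
Proof. by move=> bf bg; rewrite RintegralD//; exact: bmf_integrable. Qed.

Lemma meanB f g : bmf f -> bmf g ->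
  \int[P]_w (f w - g w) = mean f - mean g.
Proof. by move=> bf bg; rewrite RintegralB//; exact: bmf_integrable. Qed.

Lemma meanZ (c : R) f : bmf f -> \int[P]_w (c * f w) = c * mean f.
Proof. by move=> bf; rewrite RintegralZl//; exact: bmf_integrable. Qed.

Lemma mean_cst (c : R) : \int[P]_w c = c.
Proof.
rewrite Rintegral_cst// [X in fine X](_ : _ = 1%E) ?mulr1//.
exact: probability_setT.
Qed.

Lemma le_mean f g : bmf f -> bmf g -> (forall w, f w <= g w) ->
  mean f <= mean g.
Proof. by move=> bf bg fg; apply: le_Rintegral => //; exact: bmf_integrable. Qed.

Lemma mean_ge0 f : (forall w, 0 <= f w) -> 0 <= mean f.
Proof. by move=> f0; apply: Rintegral_ge0. Qed.

Lemma bmf_norm f : bmf f -> bmf (fun w => `|f w|).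
Proof.
move=> [mf [M hM]]; split; first exact: measurableT_comp.
by exists M => w; rewrite normr_id.
Qed.

Lemma le_norm_mean f : bmf f -> `|mean f| <= \int[P]_w `|f w|.
Proof. by move=> bf; apply: le_normr_Rintegral => //; exact: bmf_integrable. Qed.

Lemma norm_mean_le f (M : R) : bmf f -> (forall w, `|f w| <= M) -> `|mean f| <= M.
Proof.
move=> bf hM; apply: (le_trans (le_norm_mean bf)).
rewrite -[leRHS]mean_cst; apply: le_mean => //; first exact: bmf_norm.
exact: bmf_cst.
Qed.

Lemma mean_sum (I : Type) (r : seq I) (Q : pred I) (f : I -> T -> R) :
  (forall i, bmf (f i)) ->
  \int[P]_w (\sum_(i <- r | Q i) f i w) = \sum_(i <- r | Q i) mean (f i).
Proof.
move=> bf; elim: r => [|i r ih].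
  rewrite big_nil -[RHS](mean_cst 0); apply: eq_Rintegral => w _.
  by rewrite big_nil.
rewrite big_cons -ih.
case: ifPn => Qi.
  rewrite -meanD//; last exact: bmf_sum.
  by apply: eq_Rintegral => w _; rewrite big_cons Qi.
by apply: eq_Rintegral => w _; rewrite big_cons (negbTE Qi).
Qed.

Lemma mean_eq0_ae f : bmf f -> (forall w, 0 <= f w) -> mean f = 0 ->
  measurable [set w | f w = 0] /\ P [set w | f w = 0] = 1%E.
Proof.
move=> bf f0 mf0.
have mf : measurable_fun setT f by case: bf.
have mN : measurable [set w | f w = 0].
  rewrite -[X in measurable X]setTI; apply: (mf measurableT [set 0]).
  exact: measurable_set1.
split => //.
have h : (\int[P]_w `|(f w)%:E| = 0)%E.
  have h0 := bmf_expectation bf; rewrite unlock mf0 in h0.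
  rewrite -[RHS]h0.
  by apply: eq_integral => w _; rewrite gee0_abs// lee_fin.
have [/(_ h) [A [mA A0 hA]] _] := ae_eq_integral_abs P measurableT
  ((measurable_EFinP _ _).2 mf).
apply/eqP; rewrite eq_le probability_le1//=.
have -> : [set w | f w = 0] = ~` (~` [set w | f w = 0]) by rewrite setCK.
rewrite probability_setC; last exact: measurableC.
suff -> : P (~` [set w | f w = 0]) = 0%E by rewrite sube0.
apply/eqP; rewrite -measure_le0 -A0; apply: le_measure => //=.
- by rewrite inE; exact: measurableC.
- by rewrite inE.
move=> w /= fw; apply: hA => /=; apply/not_implyP; split => // -[] //.
Qed.

(* The variance of the unit vector (cos g, sin g). *)
Lemma mean_unit_variance f : measurable_fun setT f ->
  \int[P]_w ((cos (f w) - mean (cos \o f)) ^+ 2 +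
             (sin (f w) - mean (sin \o f)) ^+ 2) =
  1 - (mean (cos \o f) ^+ 2 + mean (sin \o f) ^+ 2).
Proof.
move=> mf; have bc := bmf_cos mf; have bs := bmf_sin mf.
set c := mean (cos \o f); set s := mean (sin \o f).
transitivity (\int[P]_w ((1 + c ^+ 2 + s ^+ 2) - (2 * c * cos (f w) + 2 * s * sin (f w)))).
  apply: eq_Rintegral => w _.
  by rewrite -[X in X + c ^+ 2](cos2Dsin2 (f w)) /=; ring.
rewrite meanB; [|exact: bmf_cst|by apply: bmfD; exact: bmfZ].
rewrite mean_cst meanD; [|exact: bmfZ|exact: bmfZ].
rewrite !meanZ//.
by transitivity (1 + c ^+ 2 + s ^+ 2 - (2 * c * c + 2 * s * s)) => //; ring.
Qed.

Lemma mean_unit_le1 f : measurable_fun setT f ->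
  mean (cos \o f) ^+ 2 + mean (sin \o f) ^+ 2 <= 1.
Proof.
move=> mf; rewrite -subr_ge0 -mean_unit_variance//.
by apply: mean_ge0 => w; rewrite addr_ge0// sqr_ge0.
Qed.

(** A random unit vector whose mean has length 1 has variance 0, so it almost surely equals its
    mean. *)
Lemma mean_unit_eq1 f : measurable_fun setT f ->
  mean (cos \o f) ^+ 2 + mean (sin \o f) ^+ 2 = 1 ->
  exists A : set T, [/\ measurable A, P A = 1%E &
    forall w, A w -> cos (f w) = mean (cos \o f) /\ sin (f w) = mean (sin \o f)].
Proof.
move=> mf h1; have := mean_unit_variance mf; rewrite h1 subrr => /mean_eq0_ae h.
have [|w|mA PA] := h.
- apply: bmfD; apply: (@bmfX _ 2); apply: bmfB; try exact: bmf_cst.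
    exact: bmf_cos.
  exact: bmf_sin.
- by rewrite addr_ge0// sqr_ge0.
exists [set w | (cos (f w) - mean (cos \o f)) ^+ 2 +
             (sin (f w) - mean (sin \o f)) ^+ 2 = 0]; split => // w /= /eqP.
rewrite paddr_eq0 ?sqr_ge0// !sqrf_eq0 !subr_eq0 => /andP[/eqP -> /eqP ->].
by [].
Qed.

End bounded_measurable.

(** * Characteristic functions *)

Section trigonometry.
Context {R : realType}.
Implicit Types x y : R.

Lemma norm_cos_le1 x : `|cos x| <= 1.
Proof. by rewrite ler_norml cos_geN1 cos_le1. Qed.

Lemma norm_sin_le1 x : `|sin x| <= 1.
Proof. by rewrite ler_norml sin_geN1 sin_le1. Qed.

Lemma cos_lipschitz x y : `|cos x - cos y| <= `|x - y|.
Proof.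
wlog xy : x y / x < y.
  move=> h; have [xy|yx|->] := ltgtP x y; first exact: h.
    by rewrite distrC [leRHS]distrC; exact: h.
  by rewrite !subrr.
have [|c _ E] := @MVT R cos (fun z => - sin z) x y xy (fun z _ => is_derive_cos z).
  by apply: continuous_subspaceT; exact: continuous_cos.
rewrite distrC E normrM normrN [leRHS]distrC.
by rewrite ler_piMl// norm_sin_le1.
Qed.

Lemma sin_lipschitz x y : `|sin x - sin y| <= `|x - y|.
Proof.
have h z : sin z = cos (z - pi / 2) by rewrite cosBpihalf.
rewrite !h (le_trans (cos_lipschitz _ _))//.
by rewrite (_ : x - pi / 2 - (y - pi / 2) = x - y) //; ring.
Qed.

Lemma cos_lipschitz_min x y : `|cos x - cos y| <= 2 * Num.min 1 `|x - y|.
Proof.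
rewrite minr_pMr// le_min mulr1; apply/andP; split.
  by rewrite (le_trans (ler_normB _ _))// (_ : 2 = 1 + 1)// lerD// norm_cos_le1.
by rewrite (le_trans (cos_lipschitz _ _))// ler_peMl// ler1n.
Qed.

Lemma sin_lipschitz_min x y : `|sin x - sin y| <= 2 * Num.min 1 `|x - y|.
Proof.
rewrite minr_pMr// le_min mulr1; apply/andP; split.
  by rewrite (le_trans (ler_normB _ _))// (_ : 2 = 1 + 1)// lerD// norm_sin_le1.
by rewrite (le_trans (sin_lipschitz _ _))// ler_peMl// ler1n.
Qed.

Lemma cos_eq1_small x : `|x| <= pi -> cos x = 1 -> x = 0.
Proof.
move=> xpi cx; apply/normr0_eq0/cos_inj; rewrite ?in_itv/=.
- by rewrite normr_ge0.
- by rewrite lexx pi_ge0.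
rewrite cos0; case: (ger0P x) => _ //; by rewrite cosN.
Qed.

End trigonometry.

Section dot_product.
Context {R : realType} {d : nat}.
Implicit Types u v w : 'rV[R]_d.

Definition dot u v : R := \sum_j u 0 j * v 0 j.

Lemma dotDr u v w : dot u (v + w) = dot u v + dot u w.
Proof. by rewrite -big_split; apply: eq_bigr => j _; rewrite mxE mulrDr. Qed.

Lemma dotZr c u v : dot u (c *: v) = c * dot u v.
Proof. by rewrite mulr_sumr; apply: eq_bigr => j _; rewrite mxE mulrCA. Qed.

Lemma dotC u v : dot u v = dot v u.
Proof. by apply: eq_bigr => j _; rewrite mulrC. Qed.

Lemma dotZl c u v : dot (c *: u) v = c * dot u v.
Proof. by rewrite dotC dotZr dotC. Qed.

Lemma dotBr u v w : dot u (v - w) = dot u v - dot u w.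
Proof. by rewrite dotDr -scaleN1r dotZr mulN1r. Qed.

Lemma dotBl u v w : dot (u - v) w = dot u w - dot v w.
Proof. by rewrite dotC dotBr !(dotC w). Qed.

Lemma norm_coord_le u j : `|u 0 j| <= `|u|.
Proof. by rewrite [leRHS]/Num.norm/= mx_normrE; apply/bigmax_geP; right; exists (0, j). Qed.

Lemma norm_le_coord u (c : R) : 0 <= c -> (forall j, `|u 0 j| <= c) -> `|u| <= c.
Proof.
move=> c0 uc; rewrite [leLHS]/Num.norm/= mx_normrE bigmax_le// => -[i j] _ /=.
by rewrite (ord1 i).
Qed.

Lemma norm_dot_le u v : `|dot u v| <= d%:R * `|u| * `|v|.
Proof.
rewrite (le_trans (ler_norm_sum _ _ _))//.
rewrite (_ : d%:R * `|u| * `|v| = \sum_(j < d) `|u| * `|v|); last first.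
  by rewrite sumr_const card_ord -[RHS]mulr_natl mulrA.
rewrite ler_sum// => j _.
by rewrite normrM ler_pM// norm_coord_le.
Qed.

Lemma dot_eq0 u : dot u u = 0 -> u = 0.
Proof.
move=> /eqP; rewrite psumr_eq0 => [/allP h|j _]; last by rewrite -expr2 sqr_ge0.
apply/rowP => j; rewrite mxE; apply/eqP.
by have := h j; rewrite mem_index_enum mulf_eq0 orbb => /(_ isT).
Qed.

Lemma dot_continuous u : continuous (dot u : 'rV[R]_d -> R).
Proof.
move=> v; apply: (cvg_big _ (nbhs_filter v)) => [|j _]; first exact: add_continuous.
by apply: cvgM; [exact: cvg_cst|exact: coord_continuous].
Qed.

Lemma toRD (x y : 'rV[int]_d) : toR (x + y) = toR x + toR y :> 'rV[R]_d.
Proof. by apply/rowP => j; rewrite !mxE rmorphD. Qed.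

End dot_product.

Section characteristic_function.
Context {R : realType} {disp : measure_display} {T : measurableType disp}.
Variable P : probability T R.
Local Notation mean f := (\int[P]_w f w).

Lemma bmf_min1 (g : T -> R) : measurable_fun setT g -> (forall w, 0 <= g w) ->
  bmf (fun w => Num.min 1 (g w)).
Proof.
move=> mg g0; split; first by apply: measurable_minr.
by exists 1 => w; rewrite ger0_norm ?le_min ?g0 ?ler01// ge_min lexx.
Qed.

(** Tightness in a form that asks for no moment of [g]: the truncation at 1 provides the dominating
    function, and it is continuous, hence compatible with convergence in law. *)
Lemma mean_min1_small (g : T -> R) : measurable_fun setT g ->
  (forall w, 0 <= g w) -> forall e, 0 < e ->
  exists2 eta, 0 < eta & \int[P]_w (Num.min 1 (eta * g w)) < e.
Proof.
move=> mg g0 e e0.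
pose h n w := Num.min 1 (n.+1%:R^-1 * g w).
have mh n : measurable_fun setT (h n).
  by apply: measurable_minr => //; apply: measurable_funM.
have h0 n w : 0 <= h n w by rewrite le_min ler01/= mulr_ge0// invr_ge0.
have h1 n w : h n w <= 1 by rewrite ge_min lexx.
have bh n : bmf (h n).
  by apply: bmf_min1 => [|w]; [exact: measurable_funM|rewrite mulr_ge0// invr_ge0].
have m1 n : measurable_fun setT (fun w => (h n w)%:E) by exact/measurable_EFinP.
have m2 : measurable_fun setT (fun _ : T => 0%E : \bar R) by exact: measurable_cst.
have m3 : {ae P, forall w, setT w -> (fun n => (h n w)%:E) @ \oo --> 0%E}.
  apply: aeW => w _; apply: cvg_EFin; first exact: nearW.
  rewrite /=; apply/cvgrPdist_lt => r r0.
  near=> n; rewrite sub0r normrN /= ger0_norm// gt_min; apply/orP; right.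
  rewrite ltr_pdivrMl//.
  rewrite -ltr_pdivrMr//.
  near: n.
  exists (Num.truncn (g w / r)) => // n /= hn.
  by rewrite (lt_le_trans (truncnS_gt _))// ler_nat ltnS.
have m4 : P.-integrable setT (fun=> 1%E) by exact: (bmf_integrable P (bmf_cst 1)).
have m5 : {ae P, forall w n, setT w -> (`|(h n w)%:E| <= 1)%E}.
  by apply: aeW => w n _; rewrite /= ger0_norm ?lee_fin.
have [_ _] := dominated_convergence measurableT m1 m2 m3 m4 m5.
rewrite integral0 => /fine_cvg /cvgrPdist_lt /(_ _ e0) [n _ /(_ _ (leqnn n))] /=.
rewrite sub0r normrN => hn; exists n.+1%:R^-1; first by rewrite invr_gt0.
by apply: le_lt_trans hn; exact: ler_norm.
Unshelve. all: by end_near. Qed.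

Context {d : nat}.
Variable Z : T -> 'rV[R]_d.
Hypothesis mdotZ : forall t, measurable_fun setT (fun w => dot t (Z w)).
Hypothesis mnormZ : measurable_fun setT (fun w => `|Z w|).

(* The squared modulus of the characteristic function of Z. *)
Definition chf2 (t : 'rV[R]_d) : R :=
  mean (fun w => cos (dot t (Z w))) ^+ 2 + mean (fun w => sin (dot t (Z w))) ^+ 2.

Lemma chf2_ge0 t : 0 <= chf2 t.
Proof. by rewrite addr_ge0// sqr_ge0. Qed.

Lemma chf2_le1 t : chf2 t <= 1.
Proof. exact: (mean_unit_le1 P (mdotZ t)). Qed.

(** The truncated Lipschitz bound of cos and sin costs a factor 2, a difference of squares of
    numbers in [-1, 1] another 2, and there are two squares: hence 8. *)
Lemma chf2_lipschitz t s : `|chf2 t - chf2 s| <=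
  8 * \int[P]_w (Num.min 1 (d%:R * `|t - s| * `|Z w|)).
Proof.
have bc u : bmf (fun w => cos (dot u (Z w))) by exact: bmf_cos.
have bs u : bmf (fun w => sin (dot u (Z w))) by exact: bmf_sin.
set e := \int[P]_w _.
have bm : bmf (fun w => Num.min 1 (d%:R * `|t - s| * `|Z w|)).
  by apply: bmf_min1 => [|w]; [exact: measurable_funM|rewrite !mulr_ge0].
have hmin w : Num.min 1 `|dot t (Z w) - dot s (Z w)| <=
              Num.min 1 (d%:R * `|t - s| * `|Z w|).
  by rewrite -dotBl le_min !ge_min lexx/= norm_dot_le orbT.
have sq (a b : R) : `|a| <= 1 -> `|b| <= 1 -> `|a - b| <= 2 * e ->
    `|a ^+ 2 - b ^+ 2| <= 4 * e.
  move=> a1 b1 ab; rewrite subr_sqr normrM.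
  have : `|a + b| <= 2 by rewrite (le_trans (ler_normD _ _))// (_ : 2 = 1 + 1)// lerD.
  move=> ab2; rewrite (le_trans (ler_pM _ _ ab ab2))//; lra.
have Cd : `|mean (fun w => cos (dot t (Z w))) - mean (fun w => cos (dot s (Z w)))| <= 2 * e.
  rewrite -meanB//.
  apply: (le_trans (le_norm_mean P (bmfB (bc t) (bc s)))).
  rewrite /e -meanZ//; apply: le_mean => //.
  - exact: (bmf_norm (bmfB (bc t) (bc s))).
  - exact: bmfZ.
  by move=> w; rewrite (le_trans (cos_lipschitz_min _ _))// ler_pM2l.
have Sd : `|mean (fun w => sin (dot t (Z w))) - mean (fun w => sin (dot s (Z w)))| <= 2 * e.
  rewrite -meanB//.
  apply: (le_trans (le_norm_mean P (bmfB (bs t) (bs s)))).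
  rewrite /e -meanZ//; apply: le_mean => //.
  - exact: (bmf_norm (bmfB (bs t) (bs s))).
  - exact: bmfZ.
  by move=> w; rewrite (le_trans (sin_lipschitz_min _ _))// ler_pM2l.
have c1 u : `|mean (fun w => cos (dot u (Z w)))| <= 1.
  by apply: norm_mean_le => // w; exact: norm_cos_le1.
have s1 u : `|mean (fun w => sin (dot u (Z w)))| <= 1.
  by apply: norm_mean_le => // w; exact: norm_sin_le1.
rewrite /chf2 opprD addrACA (le_trans (ler_normD _ _))//.
rewrite (_ : 8 * e = 4 * e + 4 * e); last by ring.
by rewrite lerD//; apply: sq.
Qed.

Lemma mean_min1_mono (a b : R) : 0 <= a -> a <= b ->
  \int[P]_w (Num.min 1 (a * `|Z w|)) <= \int[P]_w (Num.min 1 (b * `|Z w|)).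
Proof.
move=> a0 ab.
have bm c : 0 <= c -> bmf (fun w => Num.min 1 (c * `|Z w|)).
  by move=> c0; apply: bmf_min1 => [|w]; [exact: measurable_funM|rewrite mulr_ge0].
apply: le_mean; [exact: bm|by apply: bm; exact: le_trans ab|move=> w].
by rewrite le_min !ge_min lexx/= ler_wpM2r ?orbT.
Qed.

(** The modulus of continuity depends on [Z] only through a truncated mean of its norm, so a bound
    on this mean that is uniform over a family yields equicontinuity. *)
Lemma chf2_uniform_continuous (eta e : R) : 0 < eta ->
  \int[P]_w (Num.min 1 (eta * `|Z w|)) < e ->
  forall t s, d%:R * `|t - s| <= eta -> `|chf2 t - chf2 s| < 8 * e.
Proof.
move=> eta0 he t s ts; rewrite (le_lt_trans (chf2_lipschitz t s))// ltr_pM2l//.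
by apply: le_lt_trans he; apply: mean_min1_mono; rewrite ?mulr_ge0.
Qed.

End characteristic_function.

(** * Borel measurability and means under equal laws *)

Section borel_functions.
Context {R : realType} {d : nat}.

Lemma borel_open (V : ptopologicalType) (A : set V) : open A -> measurable (A : set (borel V)).
Proof. exact: sub_sigma_algebra. Qed.

Lemma continuous_borel (V : ptopologicalType) (f : V -> R) :
  continuous f -> measurable_fun setT (f : borel V -> R).
Proof.
move=> /continuousP cf; apply: (measurability _ (RGenOpens.measurableE R)).
move=> _ [_ [a [b ->] <-]]; rewrite setTI; apply: borel_open.
exact/cf/interval_open.
Qed.

Lemma borel_dot (t : 'rV[R]_d) : measurable_fun setT (dot t : borel 'rV[R]_d -> R).
Proof.
apply: (@continuous_borel _ (dot t)).
exact: dot_continuous.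
Qed.

Lemma borel_norm : measurable_fun setT ((fun y => `|y : 'rV[R]_d|) : borel 'rV[R]_d -> R).
Proof.
apply: (@continuous_borel _ (fun y : 'rV[R]_d => `|y|)).
exact: (@norm_continuous R 'rV[R]_d).
Qed.

End borel_functions.

Section equal_laws.
Context {R : realType} {d1 d2 : measure_display}.
Context {T1 : measurableType d1} {T2 : measurableType d2}.
Variables (P1 : probability T1 R) (P2 : probability T2 R).

Lemma eq_mean_law (f1 : T1 -> R) (f2 : T2 -> R) (g : R -> R) :
  measurable_fun setT f1 -> measurable_fun setT f2 ->
  bmf g ->
  (forall A, measurable A -> P1 (f1 @^-1` A) = P2 (f2 @^-1` A)) ->
  \int[P1]_w g (f1 w) = \int[P2]_w g (f2 w).
Proof.
move=> m1 m2 [mg [M hM]] h.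
rewrite /Rintegral; congr fine.
have mEg : measurable_fun setT (EFin \o g) by apply/measurable_EFinP.
have i1 : P1.-integrable (f1 @^-1` setT) ((EFin \o g) \o f1).
  rewrite preimage_setT; apply: (bmf_integrable P1 (f := g \o f1)).
  by split; [exact: measurableT_comp|exists M => w; exact: hM].
have i2 : P2.-integrable (f2 @^-1` setT) ((EFin \o g) \o f2).
  rewrite preimage_setT; apply: (bmf_integrable P2 (f := g \o f2)).
  by split; [exact: measurableT_comp|exists M => w; exact: hM].
have := integral_pushforward m1 mEg i1 measurableT.
have := integral_pushforward m2 mEg i2 measurableT.
rewrite !preimage_setT => <- <-.
apply: eq_measure_integral => A mA _; exact: h.
Qed.

End equal_laws.

(** * Independence and the walk *)

Section countable_variables.
Context {R : realType} {disp : measure_display} {Omega : measurableType disp}.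
Variable P : probability Omega R.
Local Notation mean f := (\int[P]_w f w).

Lemma measurable_preimage_countable (T : countType) (U : Omega -> T) :
  (forall u, measurable (U @^-1` [set u])) -> forall A, measurable (U @^-1` A).
Proof.
move=> mU A.
rewrite (_ : U @^-1` A = \bigcup_k
  (if choice.unpickle k is Some u then
     (if u \in A then U @^-1` [set u] else set0) else set0)).
  apply: bigcupT_measurable => k; case: (choice.unpickle _) => // u.
  by case: ifP => // _.
apply/seteqP; split => [w Aw|w [k _]].
  by exists (choice.pickle (U w)) => //; rewrite choice.pickleK mem_set.
by case: (choice.unpickle _) => // u; case: ifPn => // /set_mem Au /= ->.
Qed.

Lemma bmf_countable (T : countType) (U : Omega -> T) (f : T -> R) (M : R) :
  (forall u, measurable (U @^-1` [set u])) -> (forall u, `|f u| <= M) ->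
  bmf (fun w => f (U w)).
Proof.
move=> mU hM; split; last by exists M.
move=> _ B _; rewrite setTI.
rewrite (_ : _ @^-1` B = U @^-1` (f @^-1` B))//.
exact: measurable_preimage_countable.
Qed.

(** Conditioning on the value of [U], listed by its code. A number that codes no value labels an
    empty event, so the default 0 is harmless. *)
Lemma integral_countable (T : countType) (U : Omega -> T) (f : T -> R) (M : R)
    (V : Omega -> R) :
  (forall u, measurable (U @^-1` [set u])) -> (forall u, `|f u| <= M) ->
  bmf V ->
  (\int[P]_w (f (U w) * V w)%:E =
   \sum_(k <oo) (oapp f 0 (choice.unpickle k))%:E *
     \int[P]_(w in [set w | choice.pickle (U w) = k]) (V w)%:E)%E.
Proof.
move=> mU hM bV.
pose D k := [set w | choice.pickle (U w) = k].
have mD k : measurable (D k).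
  exact: (measurable_preimage_countable mU [set u | choice.pickle u = k]).
have UD : setT = \bigcup_k D k.
  by apply/seteqP; split => // w _; exists (choice.pickle (U w)).
have bfV : bmf (fun w => f (U w) * V w) by apply: bmfM => //; exact: bmf_countable hM.
rewrite {1}UD integral_bigcup//; last first.
- by rewrite -UD; exact: bmf_integrable.
- by apply/trivIsetP => i j _ _ ij; apply/seteqP;
  split => // w [/= iw jw]; move: ij; rewrite -iw -jw eqxx.
apply: eq_eseriesr => k _.
rewrite -(integralZl (mD k)); last first.
  exact: integrableS measurableT (mD k) _ (bmf_integrable P bV).
apply: eq_integral => w /set_mem <-.
by rewrite choice.pickleK.
Qed.

Lemma eq_mean_countable (T : countType) (U U' : Omega -> T) (f : T -> R) (M : R) :
  (forall u, measurable (U @^-1` [set u])) ->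
  (forall u, measurable (U' @^-1` [set u])) ->
  (forall A, P (U @^-1` A) = P (U' @^-1` A)) -> (forall u, `|f u| <= M) ->
  mean (f \o U) = mean (f \o U').
Proof.
move=> mU mU' PU hM; rewrite /Rintegral; congr fine.
have h (V : Omega -> T) (w : Omega) : (f (V w))%:E = (f (V w) * 1)%:E by rewrite mulr1.
under eq_integral do rewrite h.
under [RHS]eq_integral do rewrite h.
rewrite (integral_countable mU hM (bmf_cst 1)).
rewrite (integral_countable mU' hM (bmf_cst 1)).
apply: eq_eseriesr => k _; congr (_ * _)%E.
rewrite !integral_cst//; first by congr (_ * _)%E; exact: (PU [set u | choice.pickle u = k]).
- exact: (measurable_preimage_countable mU' [set u | choice.pickle u = k]).
- exact: (measurable_preimage_countable mU [set u | choice.pickle u = k]).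
Qed.

Lemma mean_countable (T : countType) (U : Omega -> T) (f : T -> R) (M : R)
    (V : Omega -> R) (c : R) :
  (forall u, measurable (U @^-1` [set u])) -> (forall u, `|f u| <= M) ->
  bmf V ->
  (forall u, \int[P]_(w in U @^-1` [set u]) V w = c * fine (P (U @^-1` [set u]))) ->
  \int[P]_w (f (U w) * V w) = c * mean (f \o U).
Proof.
move=> mU hM bV hV.
have bfU : bmf (fun w => f (U w)) by exact: bmf_countable hM.
rewrite -meanZ//.
rewrite [RHS](@eq_Rintegral _ _ _ _ _ (fun w => f (U w) * c)); last first.
  by move=> w _; rewrite mulrC.
rewrite /Rintegral (integral_countable mU hM bV).
rewrite (integral_countable mU hM (bmf_cst c)).
congr fine; apply: eq_eseriesr => k _.
case E : (choice.unpickle k) => [u|]; last by rewrite !mul0e.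
have [pk|pk] := eqVneq (choice.pickle u) k; last first.
  rewrite (_ : [set w | _] = set0) ?integral_set0//.
  apply/seteqP; split => // w /= Uw; move: pk E; rewrite -Uw choice.pickleK.
  by move=> /[swap] -[->]; rewrite eqxx.
congr (_ * _)%E.
rewrite (_ : [set w | _] = U @^-1` [set u]); last first.
  apply/seteqP; split => w /=; rewrite -pk; last by move->.
  by move=> /(pcan_inj choice.pickleK).
have mUu := mU u.
have Pfin : P (U @^-1` [set u]) \is a fin_num.
  by rewrite fin_num_measure.
have Vfin : (\int[P]_(w in U @^-1` [set u]) (V w)%:E)%E \is a fin_num.
  apply: integrable_fin_num => //; exact: integrableS measurableT mUu _ (bmf_integrable P bV).
rewrite integral_cst// -[LHS]fineK// -[X in _ = (_ * X)%E]fineK// -EFinM.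
by congr EFin; exact: hV.
Qed.

(** Independence is needed on atoms only: [mean_countable] reduces [U] to its atoms, and then [V],
    against the indicator of an atom of [U]. *)
Lemma mean_indep (T T' : countType) (U : Omega -> T) (V : Omega -> T')
    (f : T -> R) (h : T' -> R) (M N : R) :
  (forall u, measurable (U @^-1` [set u])) ->
  (forall v, measurable (V @^-1` [set v])) ->
  (forall u v, P (U @^-1` [set u] `&` V @^-1` [set v]) =
               (P (U @^-1` [set u]) * P (V @^-1` [set v]))%E) ->
  (forall u, `|f u| <= M) -> (forall v, `|h v| <= N) ->
  \int[P]_w (f (U w) * h (V w)) = mean (f \o U) * mean (h \o V).
Proof.
move=> mU mV ind hM hN; rewrite mulrC.
have bhV : bmf (fun w => h (V w)) by exact: bmf_countable hN.
apply: (mean_countable mU hM bhV) => u.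
rewrite mulrC Rintegral_mkcond.
rewrite (@eq_Rintegral _ _ _ _ _ (fun w => h (V w) * \1_(U @^-1` [set u]) w)); last first.
  by move=> w _; rewrite patchE indicE; case: ifP; rewrite ?mulr1 ?mulr0.
have b1 : bmf (\1_(U @^-1` [set u]) : Omega -> R).
  split; first exact: measurable_indic.
  by exists 1 => w; rewrite indicE; case: (_ \in _); rewrite ?normr1 ?normr0.
apply: (mean_countable mV hN b1) => v.
rewrite /Rintegral integral_indic//.
rewrite [X in fine X](_ : _ = (P (U @^-1` [set u]) * P (V @^-1` [set v]))%E).
  by rewrite fineM ?fin_num_measure.
by rewrite -ind; congr (P _).
Qed.

End countable_variables.

Section walk.
Context {R : realType} {disp : measure_display} {Omega : measurableType disp}.
Variable P : probability Omega R.
Context {d : nat}.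
Variable X : nat -> Omega -> 'rV[int]_d.
Hypothesis X_iid : iid P X.
Local Notation mean f := (\int[P]_w f w).

(** The whole past as a single variable with values in a countable type, so that its independence
    from the next step is that of two discrete variables. *)
Definition history (m : nat) (w : Omega) : seq 'rV[int]_d :=
  [seq X i w | i <- iota 0 m].

Lemma history_preimage m u : history m @^-1` [set u] =
  if size u == m then \bigcap_(j in [set` [fset j in iota 0 m]%fset])
    (X j @^-1` [set nth 0 u j]) else set0.
Proof.
apply/seteqP; split => [w /= <-|w].
  rewrite size_map size_iota eqxx => j /=.
  rewrite !inE mem_iota add0n => /andP[_ jm].
  by rewrite (nth_map 0%N) ?size_iota// nth_iota.
case: ifPn => // /eqP su h; apply: (@eq_from_nth _ 0).
  by rewrite size_map size_iota.
move=> j; rewrite size_map size_iota => jm.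
rewrite (nth_map 0%N) ?size_iota// nth_iota// add0n.
by apply: h => /=; rewrite !inE mem_iota.
Qed.

Lemma measurable_X n A : measurable (X n @^-1` A).
Proof. by case: X_iid. Qed.

Lemma measurable_history m u : measurable (history m @^-1` [set u]).
Proof.
rewrite history_preimage; case: ifP => // _.
by apply: fin_bigcap_measurable => // j _; exact: measurable_X.
Qed.

Lemma history_indep m u v :
  P (history m @^-1` [set u] `&` X m @^-1` [set v]) =
  (P (history m @^-1` [set u]) * P (X m @^-1` [set v]))%E.
Proof.
rewrite history_preimage; case: ifP => _; last by rewrite set0I measure0 mul0e.
have [_ ind _] := X_iid.
set J := [fset j in iota 0 m]%fset.
have mJ : m \notin J by rewrite !inE mem_iota add0n ltnn.
pose A j := if j == m then [set v] else [set nth 0 u j].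
have AJ j : j \in J -> A j = [set nth 0 u j].
  by move=> jJ; rewrite /A; case: eqP => // jm; rewrite -jm jJ in mJ.
have hI : \bigcap_(j in [set` J]) (X j @^-1` [set nth 0 u j]) =
          \bigcap_(j in [set` J]) (X j @^-1` A j).
  by apply: eq_bigcapr => j /= jJ; rewrite AJ.
have Am : A m = [set v] by rewrite /A eqxx.
rewrite hI (_ : _ `&` _ = \bigcap_(j in [set` (m |` J)%fset]) (X j @^-1` A j)).
  by rewrite !ind big_fsetU1//= Am muleC.
apply/seteqP; split => [w [h2 h1] j /=|w h].
  by rewrite in_fsetU => /orP[|]; [rewrite inE => /eqP ->; rewrite Am|exact: h2].
split; last by rewrite -Am; apply: h => /=; rewrite !inE eqxx.
by move=> j /= jJ; apply: h => /=; rewrite in_fsetU jJ orbT.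
Qed.

Lemma history_mean_indep m (f : seq 'rV[int]_d -> R) (h : 'rV[int]_d -> R) (M N : R) :
  (forall u, `|f u| <= M) -> (forall v, `|h v| <= N) ->
  \int[P]_w (f (history m w) * h (X m w)) =
  \int[P]_w f (history m w) * \int[P]_w h (X 0%N w).
Proof.
move=> hM hN.
rewrite (mean_indep _ _ (@history_indep m) hM hN).
- congr (_ * _); apply: (eq_mean_countable _ _ _ hN).
  + by move=> u; exact: measurable_X.
  + by move=> u; exact: measurable_X.
  + by case: X_iid.
- exact: measurable_history.
- by move=> u; exact: measurable_X.
Qed.

Lemma walk_history n m w : (n <= m)%N ->
  walk X n w = \sum_(i < n) nth 0 (history m w) i.
Proof.
move=> nm; apply: eq_bigr => i _; rewrite (nth_map 0%N) ?size_iota.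
  by rewrite nth_iota// (leq_trans (ltn_ord i)).
by rewrite (leq_trans (ltn_ord i)).
Qed.

Lemma bmf_walk n (f : 'rV[int]_d -> R) (M : R) :
  (forall u, `|f u| <= M) -> bmf (fun w => f (walk X n w)).
Proof.
move=> hM; rewrite (_ : (fun w => _) = (fun w => f (\sum_(i < n) nth 0 (history n w) i))).
  apply: (@bmf_countable _ _ _ _ (history n) (fun s => f (\sum_(i < n) nth 0 s i)) M) => //.
  exact: measurable_history.
by apply/funext => w; rewrite (walk_history _ (leqnn n)).
Qed.

Definition rho (t : 'rV[R]_d) : R := chf2 P (fun w => toR (X 0%N w)) t.

Lemma walkS n w : walk X n.+1 w = walk X n w + X n w.
Proof. by rewrite /walk big_ord_recr. Qed.

(** In complex form: E[f(S_n) exp(i t.S_(m+1))] = E[f(S_n) exp(i t.S_m)] phi(t), since for n <= m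
    the first factor depends on the history alone; then take squared moduli. *)
Lemma chf_step n m (f : 'rV[int]_d -> R) (M : R) t : (n <= m)%N ->
  (forall u, `|f u| <= M) ->
  (\int[P]_w (f (walk X n w) * cos (dot t (toR (walk X m.+1 w))))) ^+ 2 +
  (\int[P]_w (f (walk X n w) * sin (dot t (toR (walk X m.+1 w))))) ^+ 2 =
  ((\int[P]_w (f (walk X n w) * cos (dot t (toR (walk X m w))))) ^+ 2 +
   (\int[P]_w (f (walk X n w) * sin (dot t (toR (walk X m w))))) ^+ 2) * rho t.
Proof.
move=> nm hM.
pose fc s := f (\sum_(i < n) nth 0 s i) * cos (dot t (toR (\sum_(i < m) nth 0 s i))).
pose fs s := f (\sum_(i < n) nth 0 s i) * sin (dot t (toR (\sum_(i < m) nth 0 s i))).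
have hfc s : `|fc s| <= M by rewrite normrM -[leRHS]mulr1 ler_pM// norm_cos_le1.
have hfs s : `|fs s| <= M by rewrite normrM -[leRHS]mulr1 ler_pM// norm_sin_le1.
pose hc (x : 'rV[int]_d) : R := cos (dot t (toR x)).
pose hs (x : 'rV[int]_d) : R := sin (dot t (toR x)).
have hhc x : `|hc x| <= 1 by exact: norm_cos_le1.
have hhs x : `|hs x| <= 1 by exact: norm_sin_le1.
have bX (g : 'rV[int]_d -> R) (N : R) : (forall x, `|g x| <= N) ->
    bmf (fun w => g (X m w)).
  by move=> hN; apply: bmf_countable hN => u; exact: measurable_X.
have bH (g : seq 'rV[int]_d -> R) (N : R) : (forall x, `|g x| <= N) ->
    bmf (fun w => g (history m w)).
  by move=> hN; apply: bmf_countable hN => u; exact: measurable_history.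
have bHX g N g' N' (hN : forall x, `|g x| <= N) (hN' : forall x, `|g' x| <= N') :=
  bmfM (bH g N hN) (bX g' N' hN').
have Efc : \int[P]_w (f (walk X n w) * cos (dot t (toR (walk X m w)))) =
    \int[P]_w fc (history m w).
  by apply: eq_Rintegral => w _; rewrite /fc -!walk_history.
have Efs : \int[P]_w (f (walk X n w) * sin (dot t (toR (walk X m w)))) =
    \int[P]_w fs (history m w).
  by apply: eq_Rintegral => w _; rewrite /fs -!walk_history.
have -> : \int[P]_w (f (walk X n w) * cos (dot t (toR (walk X m.+1 w)))) =
    \int[P]_w (fc (history m w) * hc (X m w) - fs (history m w) * hs (X m w)).
  apply: eq_Rintegral => w _; rewrite walkS toRD dotDr cosD /fc /fs -!walk_history//.
  by rewrite /hc /hs; ring.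
have -> : \int[P]_w (f (walk X n w) * sin (dot t (toR (walk X m.+1 w)))) =
    \int[P]_w (fs (history m w) * hc (X m w) + fc (history m w) * hs (X m w)).
  apply: eq_Rintegral => w _; rewrite walkS toRD dotDr sinD /fc /fs -!walk_history//.
  by rewrite /hc /hs; ring.
rewrite meanB; [|exact: bHX _ _ _ _ hfc hhc|exact: bHX _ _ _ _ hfs hhs].
rewrite meanD; [|exact: bHX _ _ _ _ hfs hhc|exact: bHX _ _ _ _ hfc hhs].
rewrite (history_mean_indep m hfc hhc) (history_mean_indep m hfs hhs).
rewrite (history_mean_indep m hfs hhc) (history_mean_indep m hfc hhs).
rewrite Efc Efs.
have -> : rho t = (\int[P]_w hc (X 0 w)) ^+ 2 + (\int[P]_w hs (X 0 w)) ^+ 2 by [].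
by ring.
Qed.

Lemma chf_walk n k (f : 'rV[int]_d -> R) (M : R) t : (forall u, `|f u| <= M) ->
  (\int[P]_w (f (walk X n w) * cos (dot t (toR (walk X (n + k) w))))) ^+ 2 +
  (\int[P]_w (f (walk X n w) * sin (dot t (toR (walk X (n + k) w))))) ^+ 2 =
  ((\int[P]_w (f (walk X n w) * cos (dot t (toR (walk X n w))))) ^+ 2 +
   (\int[P]_w (f (walk X n w) * sin (dot t (toR (walk X n w))))) ^+ 2) * rho t ^+ k.
Proof.
move=> hM; elim: k => [|k ih]; first by rewrite addn0 expr0 mulr1.
by rewrite addnS (chf_step _ (leq_addr k n) hM) ih (exprSr (rho t) k) mulrA.
Qed.

End walk.

(** * Characteristic functions of stable laws *)

Section almost_sure.
Context {R : realType} {disp : measure_display} {T : measurableType disp}.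
Variable P : probability T R.

Lemma probability_bigcap1 (A : (set T)^nat) :
  (forall k, measurable (A k)) -> (forall k, P (A k) = 1%E) ->
  P (\bigcap_k A k) = 1%E.
Proof.
move=> mA PA.
have mI : measurable (\bigcap_k A k) by exact: bigcapT_measurable.
rewrite -[X in P X]setCK probability_setC; last exact: measurableC.
suff -> : P (~` (\bigcap_k A k)) = 0%E by rewrite sube0.
apply/negligibleP; first exact: measurableC.
rewrite setC_bigcap; apply: negligible_bigcup => k.
apply/negligibleP; first exact: measurableC.
transitivity (1 - P (A k))%E; [exact: probability_setC|by rewrite PA subee].
Qed.

Lemma probability1_subset (A B : set T) : measurable A -> measurable B ->
  P A = 1%E -> A `<=` B -> P B = 1%E.
Proof.
move=> mA mB PA AB; apply/eqP; rewrite eq_le probability_le1//= -PA.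
by apply: le_measure => //; rewrite inE.
Qed.

Lemma probability1_nonempty (A : set T) : P A = 1%E -> exists w, A w.
Proof.
move=> PA; apply/set0P/eqP => A0; move: PA; rewrite A0 measure0 => /eqP.
by rewrite eqe eq_sym oner_eq0.
Qed.

End almost_sure.

Section product_mean.
Context {R : realType} {d1 d2 : measure_display}.
Context {T1 : measurableType d1} {T2 : measurableType d2}.
Variables (P1 : probability T1 R) (P2 : probability T2 R).

Lemma bmf_fst (f : T1 -> R) : bmf f -> bmf (fun z : T1 * T2 => f z.1).
Proof.
by move=> [mf [M hM]]; split; [exact: measurableT_comp|exists M => z; exact: hM].
Qed.

Lemma bmf_snd (f : T2 -> R) : bmf f -> bmf (fun z : T1 * T2 => f z.2).
Proof.
by move=> [mf [M hM]]; split; [exact: measurableT_comp|exists M => z; exact: hM].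
Qed.

Lemma mean_prod (f : T1 -> R) (g : T2 -> R) : bmf f -> bmf g ->
  Rintegral (P1 \x P2)%E setT (fun z => f z.1 * g z.2) =
  \int[P1]_x f x * \int[P2]_y g y.
Proof.
move=> bf bg.
have bfg : bmf (fun z : T1 * T2 => f z.1 * g z.2).
  by apply: bmfM; [exact: bmf_fst|exact: bmf_snd].
have ifg := bmf_integrable (P1 \x P2)%E bfg.
rewrite /Rintegral -(integral12_prod_meas1 ifg) /=.
have E x : (\int[P2]_y (f x * g y)%:E = (f x * \int[P2]_y g y)%:E)%E.
  rewrite -meanZ// /Rintegral fineK//.
  by apply: integrable_fin_num => //; exact: (bmf_integrable P2 (bmfZ (f x) bg)).
rewrite (eq_integral (fun x => (f x * \int[P2]_y g y)%:E)); last first.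
  by move=> x _; exact: E.
exact: (RintegralZr _ _ (bmf_integrable P1 bf)).
Qed.

End product_mean.

Section stable_laws_chf.
Context {R : realType} {d : nat}.
Variable mu : probability (borel 'rV[R]_d) R.
Local Notation mean f := (\int[mu]_w f w).

Definition law_chf2 (t : 'rV[R]_d) : R := chf2 mu (fun y : borel 'rV[R]_d => (y : 'rV[R]_d)) t.

Lemma measurable_dot_id t : measurable_fun setT (fun y : borel 'rV[R]_d => dot t (y : 'rV[R]_d)).
Proof. exact: borel_dot. Qed.

(** For the characteristic function itself the right side carries the phase exp(i t.c) of the
    unknown shift [c]; the squared modulus removes it. *)
Lemma stable_chf2 (alpha a b : R) (t : 'rV[R]_d) : stable_law alpha mu -> 0 < a -> 0 < b ->
  law_chf2 (a *: t) * law_chf2 (b *: t) =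
  law_chf2 ((a `^ alpha + b `^ alpha) `^ alpha^-1 *: t).
Proof.
move=> st a0 b0; have [c hc] := st a b a0 b0.
set s := (a `^ alpha + b `^ alpha) `^ alpha^-1 in hc *.
have md := measurable_dot_id.
have bc u : bmf (fun y : borel 'rV[R]_d => cos (dot u (y : 'rV[R]_d))) by exact: bmf_cos.
have bs u : bmf (fun y : borel 'rV[R]_d => sin (dot u (y : 'rV[R]_d))) by exact: bmf_sin.
pose f1 (z : borel 'rV[R]_d * borel 'rV[R]_d) : R :=
  dot (a *: t) (z.1 : 'rV[R]_d) + dot (b *: t) (z.2 : 'rV[R]_d).
pose f2 (y : borel 'rV[R]_d) : R := dot (s *: t) (y : 'rV[R]_d) + dot t c.
have mf1 : measurable_fun setT f1.
  apply: measurable_funD.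
    exact: (measurableT_comp (md (a *: t)) measurable_fst).
  exact: (measurableT_comp (md (b *: t)) measurable_snd).
have mf2 : measurable_fun setT f2 by apply: measurable_funD.
have hlaw A : measurable A -> (mu \x mu)%E (f1 @^-1` A) = mu (f2 @^-1` A).
  move=> mA; have mB : measurable ((fun y : borel 'rV[R]_d => dot t (y : 'rV[R]_d)) @^-1` A).
    by rewrite -[X in measurable X]setTI; exact: md.
  have := hc _ mB; congr (_ = _).
    by congr (_ _); apply/seteqP; split => z /=; rewrite /f1 dotDr !dotZr !dotZl.
  by congr (_ _); apply/seteqP; split => z /=; rewrite /f2 dotDr !dotZr !dotZl.
have Ec := eq_mean_law mf1 mf2 (bmf_cos (@measurable_id _ R setT)) hlaw.
have Es := eq_mean_law mf1 mf2 (bmf_sin (@measurable_id _ R setT)) hlaw.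
have bcf u : bmf (fun z : borel 'rV[R]_d * borel 'rV[R]_d => cos (dot u (z.1 : 'rV[R]_d))) :=
  bmf_fst (bc u).
have bsf u : bmf (fun z : borel 'rV[R]_d * borel 'rV[R]_d => sin (dot u (z.1 : 'rV[R]_d))) :=
  bmf_fst (bs u).
have bcn u : bmf (fun z : borel 'rV[R]_d * borel 'rV[R]_d => cos (dot u (z.2 : 'rV[R]_d))) :=
  bmf_snd (bc u).
have bsn u : bmf (fun z : borel 'rV[R]_d * borel 'rV[R]_d => sin (dot u (z.2 : 'rV[R]_d))) :=
  bmf_snd (bs u).
pose C u := mean (fun y => cos (dot u y)).
pose S u := mean (fun y => sin (dot u y)).
move: Ec; under eq_Rintegral do rewrite /f1 cosD.
under [in RHS]eq_Rintegral do rewrite /f2 cosD.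
rewrite meanB; [|exact: bmfM|exact: bmfM].
rewrite meanB; [|by apply: bmfM => //; exact: bmf_cst|by apply: bmfM => //; exact: bmf_cst].
rewrite (mean_prod mu mu (bc _) (bc _)) (mean_prod mu mu (bs _) (bs _)).
rewrite !RintegralZr//; [|exact: bmf_integrable|exact: bmf_integrable].
move: Es; under eq_Rintegral do rewrite /f1 sinD.
under [in RHS]eq_Rintegral do rewrite /f2 sinD.
rewrite meanD; [|exact: bmfM|exact: bmfM].
rewrite meanD; [|by apply: bmfM => //; exact: bmf_cst|by apply: bmfM => //; exact: bmf_cst].
rewrite (mean_prod mu mu (bs _) (bc _)) (mean_prod mu mu (bc _) (bs _)).
rewrite !RintegralZr//; [|exact: bmf_integrable|exact: bmf_integrable].
rewrite /law_chf2 /chf2 -/(C _) -/(S _) -/(C _) -/(S _) -/(C _) -/(S _).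
move=> Es Ec.
transitivity ((C (a *: t) * C (b *: t) - S (a *: t) * S (b *: t)) ^+ 2 +
  (S (a *: t) * C (b *: t) + C (a *: t) * S (b *: t)) ^+ 2); first by ring.
rewrite Es Ec.
transitivity ((C (s *: t) ^+ 2 + S (s *: t) ^+ 2) * (cos (dot t c) ^+ 2 + sin (dot t c) ^+ 2)).
  by ring.
by rewrite cos2Dsin2 mulr1.
Qed.

(* If the modulus is 1 at t then, by stability, it is 1 at t / k for every k >= 2;
   so dot t (y - p) lies in 2 pi k Z for almost all y and suitable p, hence is 0. *)
Lemma stable_chf2_lt1 (alpha : R) (t : 'rV[R]_d) : 0 < alpha -> stable_law alpha mu ->
  nondegenerate_law mu -> t != 0 -> law_chf2 t < 1.
Proof.
move=> al0 st nd t0; have md := measurable_dot_id.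
rewrite lt_neqAle chf2_le1// andbT; apply/eqP => h1.
have hk k : law_chf2 (k.+2%:R^-1 *: t) = 1.
  set a : R := k.+2%:R^-1.
  have a0 : 0 < a by rewrite invr_gt0.
  have a1 : a `^ alpha < 1.
    have one : 1 = 1 `^ alpha :> R by rewrite powR1.
    by rewrite [ltRHS]one gt0_ltr_powR// ?nnegrE ?ltW// invf_lt1// ltr1n.
  (* This second coefficient makes a^alpha + b^alpha = 1, so the modulus at [t] is the product of
     those at [a *: t] and at b t; both are at most 1, hence equal to 1. *)
  have b0 : 0 < (1 - a `^ alpha) `^ alpha^-1 by rewrite powR_gt0// subr_gt0.
  have := stable_chf2 t st a0 b0.
  rewrite -powRrM mulVf ?gt_eqF// powRr1 ?subr_ge0 ?ltW//.
  rewrite subrKC powR1 scale1r h1 => hab.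
  apply/eqP; rewrite eq_le chf2_le1//= -hab ler_piMr ?chf2_ge0// chf2_le1//.
pose u k := k.+2%:R^-1 *: t.
have hA k := mean_unit_eq1 (md (u k)) (hk k).
pose A k := sval (cid (hA k)).
have AP k : [/\ measurable (A k), mu (A k) = 1%E &
    forall y, A k y -> cos (dot (u k) y) = mean (fun y => cos (dot (u k) y)) /\
                       sin (dot (u k) y) = mean (fun y => sin (dot (u k) y))].
  exact: svalP (cid (hA k)).
have mA k : measurable (A k) by have [] := AP k.
have I1 : mu (\bigcap_k A k) = 1%E.
  by apply: probability_bigcap1 => // k; have [] := AP k.
have [p Ap] := probability1_nonempty I1.
have key y : (\bigcap_k A k) y -> dot t (y - p) = 0.
  move=> Ay; set x := dot t (y - p).
  (* The index depends on the point [y]: it is large enough to bring x / (k+2) into (-1, 1), where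
     cos takes the value 1 only at 0. *)
  pose k := Num.truncn `|x|.
  have kx : `|k.+2%:R^-1 * x| < 1.
    rewrite normrM ger0_norm ?invr_ge0// ltr_pdivrMl// mulr1.
    by rewrite (lt_trans (truncnS_gt _))// ltr_nat.
  suff : k.+2%:R^-1 * x = 0.
    by move/eqP; rewrite mulf_eq0 invr_eq0 pnatr_eq0/= => /eqP.
  apply: cos_eq1_small.
    by rewrite (le_trans (ltW kx))// (le_trans _ (pi_ge2 _))// ler1n.
  have [_ _ hk'] := AP k.
  have [cy sy] := hk' _ (Ay k I); have [cp sp] := hk' _ (Ap k I).
  rewrite /x -dotZl dotBr cosB cy sy cp sp -!expr2.
  exact: hk.
have lin_dot : linear (dot t : 'rV[R]_d -> R^o).
  by move=> c v w; rewrite dotDr dotZr.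
(* The hyperplane orthogonal to [t] has to be a [vspace] for [nondegenerate_law]; it is obtained as
   the kernel of a linear form. *)
pose dotL := HB.pack_for {linear 'rV[R]_d -> R^o} (dot t : 'rV[R]_d -> R^o)
  (GRing.isLinear.Build _ _ _ _ _ lin_dot).
pose V := lker (linfun dotL).
have VE v : (v \in V) = (dot t v == 0) by rewrite memv_ker lfunE.
have Vf : V != fullv.
  apply/eqP => VT; have : t \in V by rewrite VT memvf.
  by rewrite VE => /eqP /dot_eq0 /eqP; rewrite (negbTE t0).
apply: (nd p V Vf); apply: (probability1_subset _ _ I1).
- exact: bigcapT_measurable.
- rewrite (_ : [set y | _] = (fun y : borel 'rV[R]_d => dot t (y : 'rV[R]_d)) @^-1` [set dot t p]).
    by rewrite -[X in measurable X]setTI; apply: md => //; exact: measurable_set1.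
  apply/seteqP; split => y /=; rewrite VE dotBr subr_eq0; first by move/eqP.
  by move=> ->.
by move=> y /key /=; rewrite VE => ->.
Qed.

End stable_laws_chf.

(** * Decay of the characteristic function of a step *)

(** Serves twice: with a constant sequence for [rho] away from 0, and with the scaled walks, for
    which a gap holds only from some index on. *)
Lemma compact_uniform_gap (R : realType) (d : nat) (K : set 'rV[R]_d)
    (D : nat -> 'rV[R]_d -> R) : compact K ->
  (forall t0, K t0 -> exists n1, exists2 r, 0 < r & exists2 e, 0 < e &
    forall n t, (n1 <= n)%N -> `|t - t0| < r -> D n t <= 1 - e) ->
  exists n1, exists2 e, 0 < e & forall n t, (n1 <= n)%N -> K t -> D n t <= 1 - e.
Proof.
move=> /compact_near_coveringP cK hK.
(* A single integer is both the threshold for the indices and, through 1/(n+1), the gap; compactness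
   is then used as a covering property along the filter at infinity. *)
pose Q (n : nat) (t : 'rV[R]_d) := forall n', (n <= n')%N -> D n' t <= 1 - n.+1%:R^-1.
have [|n0 _ hn0] := cK nat \oo Q _; last first.
  exists n0, n0.+1%:R^-1; first by rewrite invr_gt0.
  by move=> n t n0n Kt; exact: (hn0 n0 (leqnn n0) t Kt).
move=> t0 /hK [n1 [r r0 [e e0 he]]].
exists (ball t0 r, [set n | (maxn n1 (Num.truncn e^-1) <= n)%N]).
  split => /=; first exact: nbhsx_ballx.
  by exists (maxn n1 (Num.truncn e^-1)).
move=> [t n] /= []; rewrite -ball_normE /= distrC geq_max => tr /andP[n1n en] n' nn'.
rewrite (le_trans (he n' t (leq_trans n1n nn') tr))// lerD2l lerN2.
rewrite invf_ple ?posrE//.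
by rewrite (le_trans (ltW (truncnS_gt _)))// ler_nat ltnS.
Qed.

Section annulus.
Context {R : realType} {d : nat}.

Lemma compact_annulus (a b : R) : compact [set t : 'rV[R]_d | a <= `|t| <= b].
Proof.
apply: bounded_closed_compact.
  exists b; split; first exact: num_real.
  by move=> x bx t /andP[_ tb]; apply: (le_trans tb); exact: ltW.
rewrite (_ : mkset _ = (fun t : 'rV[R]_d => `|t|) @^-1` [set x | a <= x] `&`
                       (fun t : 'rV[R]_d => `|t|) @^-1` [set x | x <= b]).
  apply: closedI; (apply: closed_comp => [t _|];
    [exact: (@norm_continuous R 'rV[R]_d)|first [exact: closed_ge|exact: closed_le]]).
by apply/seteqP; split => t /=; [move/andP|case=> -> ->].
Qed.

End annulus.

Section decay.
Context {R : realType} {disp : measure_display} {Omega : measurableType disp}.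
Variable P : probability Omega R.
Context {d : nat}.
Variable X : nat -> Omega -> 'rV[int]_d.
Hypothesis X_iid : iid P X.
Local Notation mean f := (\int[P]_w f w).
Local Notation rho := (rho P X).

Lemma measurable_countable (T : countType) (U : Omega -> T) (f : T -> R) :
  (forall u, measurable (U @^-1` [set u])) -> measurable_fun setT (fun w => f (U w)).
Proof.
move=> mU _ B _; rewrite setTI (_ : _ @^-1` B = U @^-1` (f @^-1` B))//.
exact: measurable_preimage_countable.
Qed.

Lemma measurable_walk n A : measurable (walk X n @^-1` A).
Proof.
rewrite (_ : walk X n @^-1` A =
    history X n @^-1` ((fun s => \sum_(i < n) nth 0 s i) @^-1` A)).
  apply: measurable_preimage_countable; exact: (measurable_history X_iid).
by apply/seteqP; split => w /=; rewrite (walk_history _ _ (leqnn n)).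
Qed.

Lemma measurable_fun_walk n (f : 'rV[int]_d -> R) :
  measurable_fun setT (fun w => f (walk X n w)).
Proof. by apply: measurable_countable => u; exact: measurable_walk. Qed.

Lemma rho_ge0 t : 0 <= rho t.
Proof. exact: chf2_ge0. Qed.

Let mdotX t : measurable_fun setT (fun w => dot t (toR (X 0%N w)) : R).
Proof.
apply: (measurable_countable (U := X 0%N) (fun x => dot t (toR x))) => u.
exact: (measurable_X X_iid).
Qed.

Let mnormX : measurable_fun setT (fun w => `|toR (X 0%N w) : 'rV[R]_d|).
Proof.
apply: (measurable_countable (U := X 0%N) (fun x => `|toR x : 'rV[R]_d|)) => u.
exact: (measurable_X X_iid).
Qed.

Lemma rho_le1 t : rho t <= 1.
Proof. exact: chf2_le1. Qed.

Lemma chf2_scale (Z : Omega -> 'rV[R]_d) (c : R) t :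
  chf2 P (fun w => c *: Z w) t = chf2 P Z (c *: t).
Proof.
by rewrite /chf2; congr (_ ^+ 2 + _ ^+ 2); apply: eq_Rintegral => w _;
  rewrite dotZr dotZl.
Qed.

Lemma rho_exp n t : rho t ^+ n = chf2 P (fun w => toR (walk X n w)) t.
Proof.
have walk0 w : walk X 0 w = 0 by rewrite /walk big_ord0.
have h1 : forall u : 'rV[int]_d, `|(fun=> 1 : R) u| <= 1 by move=> u; rewrite normr1.
have Ec k : \int[P]_w (1 * cos (dot t (toR (walk X k w)))) =
            \int[P]_w cos (dot t (toR (walk X k w))).
  by apply: eq_Rintegral => w _; rewrite mul1r.
have Es k : \int[P]_w (1 * sin (dot t (toR (walk X k w)))) =
            \int[P]_w sin (dot t (toR (walk X k w))).
  by apply: eq_Rintegral => w _; rewrite mul1r.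
have dot0 w : dot t (toR (walk X 0%N w)) = 0.
  by rewrite walk0 /dot big1// => j _; rewrite !mxE mulr0.
have Ec0 : \int[P]_w cos (dot t (toR (walk X 0%N w))) = 1.
  by rewrite -[RHS](mean_cst P 1); apply: eq_Rintegral => w _; rewrite dot0 cos0.
have Es0 : \int[P]_w sin (dot t (toR (walk X 0%N w))) = 0.
  by rewrite -[RHS](mean_cst P 0); apply: eq_Rintegral => w _; rewrite dot0 sin0.
have /= := chf_walk X_iid 0 n t h1; rewrite add0n.
by rewrite !Ec !Es Ec0 Es0 expr1n expr0n/= addr0 mul1r => <-.
Qed.

Section strong_aperiodicity.
Hypothesis X_nondegenerate : nondegenerate_walk P X.
Hypothesis X_aperiodic : aperiodic_walk P X.

Lemma cos_sin_eq1 (x : R) : cos x = 1 -> sin x = 0.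
Proof.
move=> c1; have := cos2Dsin2 x; rewrite c1 expr1n -{2}[1]addr0 => /addrI /eqP.
by rewrite sqrf_eq0 => /eqP.
Qed.

(* If the modulus is 1 at t, then dot t X_0 is a.s. constant modulo 2 pi; aperiodicity
   makes this constant 0, so X_0 stays in the subgroup of the x with dot t x in 2 pi Z. *)
Lemma rho_lt1 t : t != 0 -> `|t| <= pi -> rho t < 1.
Proof.
move=> t0 tpi; rewrite lt_neqAle rho_le1 andbT; apply/eqP => h1.
have [A [mA PA hA]] := mean_unit_eq1 (mdotX t) h1.
have [w0 Aw0] := probability1_nonempty PA.
pose tau : R := dot t (toR (X 0%N w0)).
pose G : set 'rV[int]_d := [set x | cos (dot t (toR x)) = cos tau /\
                                   sin (dot t (toR x)) = sin tau].
have PG n : P (X n @^-1` G) = 1%E.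
  have [_ _ ->] := X_iid.
  apply: (probability1_subset mA _ PA); first exact: (measurable_X X_iid).
  move=> w Aw; have [h1w h2w] := hA w Aw; have [h10 h20] := hA w0 Aw0.
  by rewrite /G /= /tau /= h1w h2w h10 h20.
pose Ev := \bigcap_n (X n @^-1` G).
have PI : P Ev = 1%E.
  by apply: probability_bigcap1 => // n; exact: (measurable_X X_iid).
have mI : measurable Ev by apply: bigcapT_measurable => n; exact: (measurable_X X_iid).
have walkI n w : Ev w -> cos (dot t (toR (walk X n w))) = cos (n%:R * tau) /\
                        sin (dot t (toR (walk X n w))) = sin (n%:R * tau).
  move=> Iw; elim: n => [|n [ihc ihs]].
    rewrite /walk big_ord0 mul0r /dot big1// => j _.
    by rewrite !mxE mulr0.
  have [Gc Gs] := Iw n I.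
  rewrite walkS toRD dotDr -natr1 mulrDl mul1r cosD sinD cosD sinD.
  by rewrite ihc ihs Gc Gs.
(* A return of positive probability must meet the event [Ev] of probability 1, on which the phase of
   the walk at time n is n tau. *)
have ret n : return_times P X n -> cos (n%:R * tau) = 1.
  move=> [_ Pn].
  have [w [w0' Iw]] : exists w, walk X n w = 0 /\ Ev w.
    apply: contrapT => /forallNP h.
    have : (P [set w | walk X n w = 0%R] <= P (~` Ev))%E.
      apply: le_measure; rewrite ?inE.
      - exact: (measurable_walk n [set 0]).
      - exact: measurableC.
      - by move=> w /= w1 Iw; apply: (h w).
    rewrite (_ : P (~` Ev) = 0%E); first by rewrite leNgt Pn.
    transitivity (1 - P Ev)%E; [exact: probability_setC|by rewrite PI subee].
  have [<- _] := walkI n w Iw.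
  by rewrite w0' /dot big1 ?cos0// => j _; rewrite !mxE mulr0.
have [_ gcd1] := X_aperiodic.
(* Without return times every integer would be a common divisor, so their gcd could not be 1. *)
have [n0 [n0_gt0 Pn0]] : exists n, return_times P X n.
  apply: contrapT => /forallNP h.
  by have := gcd1 2%N (fun n hn => False_ind _ (h n hn)).
have exg : exists n, (0 < n)%N && (cos (n%:R * tau) == 1).
  by exists n0; rewrite n0_gt0 ret/=.
(* The least positive n with n tau in 2 pi Z divides all the others, hence all return times;
   aperiodicity then gives [g = 1], that is cos tau = 1. *)
have [g /andP[g0 /eqP cg] gmin] := ex_minnP exg.
have sg := cos_sin_eq1 cg.
have cqg q : cos ((q * g)%:R * tau) = 1.
  elim: q => [|q ih]; first by rewrite mul0n mul0r cos0.
  by rewrite mulSn natrD mulrDl cosD cg sg ih mulr1 mul0r subr0.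
have gdvd n : return_times P X n -> (g %| n)%N.
  move=> /ret cn; rewrite /dvdn; apply/negPn/negP; rewrite -lt0n => r0.
  have := gmin (n %% g)%N; rewrite r0/=.
  have -> : ((n %% g)%:R : R) = n%:R - (n %/ g * g)%:R.
    by apply/eqP; rewrite eq_sym subr_eq -natrD addnC -divn_eq.
  rewrite mulrBl cosB cn cqg (cos_sin_eq1 cn) mul0r addr0 mulr1 eqxx => /(_ isT).
  by rewrite leqNgt ltn_mod g0.
have g1 : g = 1%N by apply/eqP; rewrite -dvdn1; exact: gcd1 gdvd.
have ctau : cos tau = 1 by rewrite -cg g1 mul1r.
pose H : {pred 'rV[int]_d} := fun x => cos (dot t (toR x)) == 1.
have Hz : zmod_closed H.
  split; first by rewrite unfold_in /dot big1 ?cos0// => j _; rewrite !mxE mulr0.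
  move=> x y; rewrite !unfold_in => /eqP cx /eqP cy.
  have -> : toR (x - y) = toR x - toR y :> 'rV[R]_d.
    by apply/rowP => j; rewrite !mxE rmorphB.
  by rewrite dotBr cosB cx cy (cos_sin_eq1 cx) mul0r addr0 mulr1.
have HX : P [set w | X 0%N w \in H] = 1%E.
  apply: (probability1_subset (measurable_X X_iid 0 G) _ (PG 0%N)).
    exact: (measurable_X X_iid 0 [set x | x \in H]).
  by move=> w /= [cw _]; rewrite unfold_in cw ctau.
have Hall := X_nondegenerate Hz HX.
(* The subgroup is now all of Z^d. Its unit vectors show that each coordinate of [t] has cosine 1,
   and these coordinates are at most pi in absolute value. *)
move/eqP: t0; apply; apply/rowP => j; rewrite mxE.
apply: cos_eq1_small; first by rewrite (le_trans (norm_coord_le _ _)).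
have := Hall (delta_mx 0 j); rewrite unfold_in /dot (bigD1 j)//= !mxE !eqxx/= mulr1.
rewrite big1 ?addr0 => [/eqP//|k kj].
by rewrite !mxE (negbTE kj) andbF mulr0.
Qed.

Lemma rho_gap (a : R) : 0 < a -> exists2 e, 0 < e & forall t,
  a <= `|t| <= pi -> rho t <= 1 - e.
Proof.
move=> a0.
have [|n1 [e e0 he]] := compact_uniform_gap (D := fun _ => rho) (@compact_annulus R d a pi).
  move=> t0 /andP[at0 t0pi].
  have rt0 : rho t0 < 1 by apply: rho_lt1; rewrite // -normr_gt0 (lt_le_trans a0).
  pose e := (1 - rho t0) / 2.
  have e0 : 0 < e by rewrite divr_gt0// subr_gt0.
  have e8 : 0 < e / 8 by rewrite divr_gt0.
  have [eta eta0 heta] := mean_min1_small P mnormX (fun w => normr_ge0 _) e8.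
  (* With this radius [d%:R] times the distance to [t0] is at most [eta]; the successor avoids a
     division by 0. *)
  exists 0%N, (eta / d.+1%:R); first by rewrite divr_gt0.
  exists e => // _ t _; rewrite ltr_pdivlMr// => tt0.
  have htt : d%:R * `|t - t0| <= eta.
    rewrite (le_trans _ (ltW tt0))// mulrC ler_wpM2l// ler_nat//.
  have := chf2_uniform_continuous mdotX mnormX eta0 heta htt.
  rewrite -/(rho t) -/(rho t0) ltr_norml => /andP[_]; rewrite /e; lra.
by exists e => // t; exact: (he n1).
Qed.

End strong_aperiodicity.
End decay.

(** * Decay near the origin, from the attraction to a stable law *)

Section attraction.
Context {R : realType} {disp : measure_display} {Omega : measurableType disp}.
Variable P : probability Omega R.
Context {d : nat}.
Variable X : nat -> Omega -> 'rV[int]_d.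
Hypothesis X_iid : iid P X.
Hypothesis X_centered : mean_step P X = 0.
Variable alpha : R.
Hypothesis alpha_gt1 : 1 < alpha.
Variable mu : probability (borel 'rV[R]_d) R.
Hypothesis mu_nondegenerate : nondegenerate_law mu.
Hypothesis mu_stable : stable_law alpha mu.
Hypothesis mu_attracts : cvg_in_law P
  (fun n w => (n%:R `^ alpha^-1)^-1 *: (toR (walk X n w) - n%:R *: mean_step P X)) mu.
Local Notation mean f := (\int[P]_w f w).
Local Notation rho := (rho P X).

Definition scaled_walk n w : 'rV[R]_d := (n%:R `^ alpha^-1)^-1 *: toR (walk X n w).

Lemma mean_scaled_walk_cvg (g : 'rV[R]_d -> R) (M : R) : continuous g ->
  (forall y, `|g y| <= M) ->
  (fun n => \int[P]_w g (scaled_walk n w)) @ \oo --> \int[mu]_y g (y : 'rV[R]_d).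
Proof.
move=> cg gM.
have bg n : bmf (fun w => g (scaled_walk n w)).
  exact: (bmf_walk X_iid n (f := fun x => g ((n%:R `^ alpha^-1)^-1 *: toR x)) (M := M)).
have bmu : bmf (fun y : borel 'rV[R]_d => g (y : 'rV[R]_d)).
  by split; [exact: continuous_borel|exists M].
have := mu_attracts cg (ex_intro _ M gM).
rewrite (_ : (fun n => _) = fun n => (\int[P]_w g (scaled_walk n w))%:E).
  rewrite -[X in _ --> X]fineK; last exact: integrable_fin_num (bmf_integrable mu bmu).
  by move=> /fine_cvg.
apply/funext => n; rewrite -bmf_expectation//; congr expectation.
by apply/funext => w; rewrite X_centered scaler0 subr0.
Qed.

Lemma rho_scaled_cvg t : (fun n => rho ((n%:R `^ alpha^-1)^-1 *: t) ^+ n) @ \oo --> law_chf2 mu t.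
Proof.
have cc : continuous (fun y => cos (dot t y)).
  by move=> y; apply: continuous_comp; [exact: dot_continuous|exact: continuous_cos].
have cs : continuous (fun y => sin (dot t y)).
  by move=> y; apply: continuous_comp; [exact: dot_continuous|exact: continuous_sin].
have hc := mean_scaled_walk_cvg cc (fun y => norm_cos_le1 (dot t y)).
have hs := mean_scaled_walk_cvg cs (fun y => norm_sin_le1 (dot t y)).
rewrite (_ : (fun n => _) = (fun n =>
  (\int[P]_w cos (dot t (scaled_walk n w))) ^+ 2 + (\int[P]_w sin (dot t (scaled_walk n w))) ^+ 2)).
  by rewrite /law_chf2 /chf2; apply: cvgD; apply: cvgM.
apply/funext => n; rewrite (rho_exp X_iid).
by rewrite -chf2_scale.
Qed.

Lemma min1_continuous (eta : R) : continuous (fun y : 'rV[R]_d => Num.min 1 (eta * `|y|)).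
Proof.
move=> y; apply: (@continuous_min _ _ (fun=> 1) (fun y : 'rV[R]_d => eta * `|y|)).
  by apply: cvg_cst; exact: nbhs_filter.
apply: (@continuous_comp _ _ _ (fun y : 'rV[R]_d => `|y|) (fun x => eta * x)).
  exact: (@norm_continuous R 'rV[R]_d).
exact: mulrl_continuous.
Qed.

(** The truncated norm is bounded and continuous, so the smallness of its mean passes from the limit
    law to the walk. *)
Lemma scaled_walk_tight (e : R) : 0 < e -> exists2 eta, 0 < eta &
  \forall n \near \oo, \int[P]_w (Num.min 1 (eta * `|scaled_walk n w|)) < e.
Proof.
move=> e0; have [eta eta0 heta] :=
  mean_min1_small mu (@borel_norm R d) (fun w => normr_ge0 _) e0.
exists eta => //.
have := mean_scaled_walk_cvg (@min1_continuous eta) (M := 1).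
move=> /(_ _)/cvgr_lt; apply => // y.
by rewrite ger0_norm ?ge_min ?lexx// le_min ler01 mulr_ge0// ltW.
Qed.

(** The limit law has modulus less than 1 at each point of the annulus. Pointwise convergence and
    the equicontinuity due to tightness carry this to a neighbourhood of the point for all large
    n. *)
Lemma rho_scaled_gap : exists n1, exists2 e, 0 < e & forall n t, (n1 <= n)%N ->
  1 <= `|t| <= 2 -> rho ((n%:R `^ alpha^-1)^-1 *: t) ^+ n <= 1 - e.
Proof.
apply: (compact_uniform_gap (@compact_annulus R d 1 2)
  (D := fun n t => rho ((n%:R `^ alpha^-1)^-1 *: t) ^+ n)) => t0 /andP[t01 _].
have t00 : t0 != 0 by rewrite -normr_gt0 (lt_le_trans _ t01).
have alpha0 : 0 < alpha by rewrite (lt_trans _ alpha_gt1).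
have lt1 := stable_chf2_lt1 alpha0 mu_stable mu_nondegenerate t00.
(* One [e] is spent on convergence at [t0] and one on moving from [t0] to [t], which leaves a gap of
   at least [e]. *)
pose e := (1 - law_chf2 mu t0) / 4.
have e0 : 0 < e by rewrite divr_gt0// subr_gt0.
have e8 : 0 < e / 8 by rewrite divr_gt0.
have [eta eta0 [n1 _ hn1]] := scaled_walk_tight e8.
have lte : law_chf2 mu t0 < law_chf2 mu t0 + e by rewrite ltrDl.
have [n2 _ hn2] := cvgr_lt _ (@rho_scaled_cvg t0) _ lte.
exists (maxn n1 n2), (eta / d.+1%:R); first by rewrite divr_gt0.
exists e => // n t; rewrite geq_max => /andP[n1n n2n]; rewrite ltr_pdivlMr// => tt0.
have htt : d%:R * `|t - t0| <= eta.
  by rewrite (le_trans _ (ltW tt0))// mulrC ler_wpM2l// ler_nat.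
have mdZ s : measurable_fun setT (fun w => dot s (scaled_walk n w)).
  exact: (measurable_fun_walk X_iid n (fun x => dot s ((n%:R `^ alpha^-1)^-1 *: toR x))).
have mnZ : measurable_fun setT (fun w => `|scaled_walk n w|).
  exact: (measurable_fun_walk X_iid n (fun x => `|(n%:R `^ alpha^-1)^-1 *: toR x|)).
have := chf2_uniform_continuous mdZ mnZ eta0 (hn1 n n1n) htt.
have E s : chf2 P (scaled_walk n) s = rho ((n%:R `^ alpha^-1)^-1 *: s) ^+ n.
  by rewrite (rho_exp X_iid) -chf2_scale.
have := hn2 n n2n; rewrite /= !E ltr_norml => h1 /andP[_ h2].
by move: h1 h2; rewrite /e; lra.
Qed.

(** For small nonzero t, let n be just above |t|^(-alpha): then n^(1/alpha) t lies in the annulus of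
    [rho_scaled_gap], so rho(t)^n <= 1 - e <= exp(-e). The n-th root, with n <= 2 |t|^(-alpha),
    gives c = e/2. *)
Lemma rho_decay0 : exists2 a, 0 < a & exists2 c, 0 < c & forall t,
  `|t| < a -> rho t <= expR (- (c * `|t| `^ alpha)).
Proof.
have alpha0 : 0 < alpha by rewrite (lt_trans _ alpha_gt1).
have [n1 [e e0 he]] := rho_scaled_gap.
have ee : 1 - e <= expR (- e) by rewrite (le_trans _ (expR_ge1Dx _)).
(* The second bound means |t|^alpha < 1/(n1+1), which forces the [n] chosen below to exceed [n1]. *)
exists (Num.min 1 (n1.+1%:R `^ (- alpha^-1))); first by rewrite lt_min ltr01 powR_gt0.
exists (e / 2); first by rewrite divr_gt0.
move=> t; rewrite lt_min => /andP[t1 tn].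
have [->|t0] := eqVneq t 0.
  by rewrite normr0 powR0 ?gt_eqF// mulr0 oppr0 expR0 rho_le1.
have nt0 : 0 < `|t| by rewrite normr_gt0.
set x := `|t| `^ alpha.
have x0 : 0 < x by rewrite powR_gt0.
have x1 : x <= 1.
  by rewrite /x -(powRr0 `|t|) ger_powR ?(ltW alpha0)// nt0 ltW.
pose n := (Num.truncn x^-1).+1.
have nx : x^-1 < n%:R by exact: truncnS_gt.
have nx2 : n%:R <= 2 * x^-1.
  rewrite (_ : 2 * x^-1 = x^-1 + x^-1); last by ring.
  rewrite /n -natr1 lerD//.
    by rewrite truncn_le// invr_ge0 ltW.
  by rewrite invf_ge1.
have n1n : (n1 <= n)%N.
  have : x < n1.+1%:R^-1.
    have -> : n1.+1%:R^-1 = (n1.+1%:R `^ (- alpha^-1)) `^ alpha :> R.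
      by rewrite -powRrM mulNr mulVf ?gt_eqF// powRN powRr1.
    by rewrite gt0_ltr_powR// ?nnegrE ?normr_ge0 ?powR_ge0.
  rewrite -ltf_pV2 ?posrE// ?invr_gt0// invrK => h.
  have := lt_trans h nx; by rewrite ltr_nat => /ltnW /ltnW.
have n0 : (0 : R) < n%:R by rewrite ltr0n.
pose s := (n%:R : R) `^ alpha^-1.
have s0 : 0 < s by rewrite powR_gt0.
have sa : s `^ alpha = n%:R by rewrite /s -powRrM mulVf ?gt_eqF// powRr1// ltW.
have hst : 1 <= `|s *: t| <= 2.
  rewrite normrZ (gtr0_norm s0).
  have st0 : 0 < s * `|t| by rewrite mulr_gt0.
  have sta : (s * `|t|) `^ alpha = n%:R * x by rewrite powRM ?ltW// sa.
  apply/andP; split; rewrite leNgt; apply/negP => h.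
    have : (s * `|t|) `^ alpha < 1 `^ alpha by rewrite gt0_ltr_powR// ?nnegrE ?ltW.
    by rewrite sta powR1 ltNge ltW// -ltr_pdivrMr// mul1r.
  have : 2 `^ alpha < (s * `|t|) `^ alpha by rewrite gt0_ltr_powR// ?nnegrE ?ltW.
  rewrite sta ltNge => /negP; apply.
  (* The norm to the power alpha is [n%:R * x], at most 2, and 2 <= 2^alpha because alpha > 1. *)
  apply: (@le_trans _ _ 2); first by rewrite -ler_pdivlMr.
  have h2 : (2 : R) `^ 1 <= 2 `^ alpha.
    by apply: ler_powR; [rewrite ler1n|exact: ltW].
  by rewrite powRr1 in h2.
have := he n (s *: t) n1n hst; rewrite scalerA mulVf ?gt_eqF// scale1r => hr.
have : rho t ^+ n <= expR (- (e / 2 * x)) ^+ n.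
  rewrite (le_trans hr)// (le_trans ee)// -expRM_natl ler_expR mulrN lerN2.
  rewrite (@le_trans _ _ (2 * x^-1 * (e / 2 * x)))//.
    by rewrite ler_wpM2r// mulr_ge0 ?divr_ge0 ?ltW.
  have -> : 2 * x^-1 * (e / 2 * x) = e * (x^-1 * x) * (2 / 2) by ring.
  rewrite divff// mulr1.
  by rewrite mulVf ?mulr1// gt_eqF.
by rewrite ler_pXn2r ?nnegrE// ?rho_ge0// ?expR_ge0.
Qed.

Lemma rho_decay : nondegenerate_walk P X -> aperiodic_walk P X ->
  exists2 c, 0 < c & forall t, `|t| <= pi -> rho t <= expR (- (c * `|t| `^ alpha)).
Proof.
move=> nd ap; have [a a0 [c c0 hc]] := rho_decay0.
have alpha0 : 0 < alpha by rewrite (lt_trans _ alpha_gt1).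
have [e e0 he] := rho_gap X_iid nd ap a0.
have p0 : (0 : R) < pi `^ alpha by rewrite powR_gt0// pi_gt0.
(* For |t| <= pi the second constant keeps the exponent below e, so away from 0 the gap suffices: 1
   - e <= exp(-e). *)
exists (Num.min c (e / pi `^ alpha)); first by rewrite lt_min c0 divr_gt0.
move=> t tpi; have [ta|ta] := ltP `|t| a.
  rewrite (le_trans (hc t ta))// ler_expR lerN2 ler_wpM2r ?powR_ge0//.
  by rewrite ge_min lexx.
rewrite (le_trans (he t _)) ?ta//.
rewrite (le_trans (expR_ge1Dx _))// ler_expR lerN2.
rewrite (@le_trans _ _ (e / pi `^ alpha * `|t| `^ alpha))//.
  by rewrite ler_wpM2r ?powR_ge0// ge_min lexx orbT.
rewrite -mulrA ler_piMr ?(ltW e0)// mulrC ler_pdivrMr// mul1r.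
by rewrite ge0_ler_powR ?nnegrE ?normr_ge0 ?pi_ge0// ltW.
Qed.

End attraction.

(** * Discrete Fourier analysis *)

Section angles.
Context {R : realType}.
Implicit Types x y : R.

Lemma cos_sin_addn x (n : nat) :
  cos (x + 2 * pi * n%:R) = cos x /\ sin (x + 2 * pi * n%:R) = sin x.
Proof.
elim: n => [|n [ihc ihs]]; first by rewrite mulr0 addr0.
have -> : x + 2 * pi * n.+1%:R = x + 2 * pi * n%:R + pi *+ 2.
  by rewrite -natr1; ring.
by rewrite cosD2pi sinD2pi.
Qed.

Lemma cos_sin_congr x y (z : int) : x = y + 2 * pi * z%:~R ->
  cos x = cos y /\ sin x = sin y.
Proof.
move=> ->; case: z => n; first exact: cos_sin_addn.
have [hc hs] := cos_sin_addn (y + 2 * pi * (Negz n)%:~R) n.+1.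
rewrite -hc -hs NegzE mulrNz -pmulrn.
by rewrite (_ : _ + _ + _ = y)//; ring.
Qed.

(** Half the angle lies strictly between 0 and pi, where sin is positive, and cos(2a) = 1 - 2
    sin(a)^2. *)
Lemma cos_eq1_dvdn (M r : nat) : (0 < r < M)%N -> cos (2 * pi * (r%:R / M%:R)) != 1 :> R.
Proof.
move=> /andP[r0 rM]; apply/eqP => c1.
have M0 : (0 : R) < M%:R by rewrite ltr0n (leq_trans _ rM).
pose a : R := pi * (r%:R / M%:R).
have sa : 0 < sin a.
  have rM' : (0 : R) < r%:R / M%:R by rewrite divr_gt0// ltr0n.
  have pi0 := pi_gt0 R.
  apply: sin_gt0_pi; apply/andP; split; first exact: mulr_gt0.
  by rewrite gtr_pMr// ltr_pdivrMr// mul1r ltr_nat.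
have : cos (a + a) = 1 by rewrite -c1; congr cos; rewrite /a; ring.
rewrite cosD -!expr2 => h; have h2 := cos2Dsin2 a.
have /eqP : sin a ^+ 2 = 0 by move: h h2; set u := cos a ^+ 2; set v := sin a ^+ 2; lra.
by rewrite sqrf_eq0 (gt_eqF sa).
Qed.

End angles.

Section discrete_fourier.
Context {R : realType} {d : nat}.
Variable m : nat.

Local Notation M := (m.*2.+1).
Local Notation grid := {ffun 'I_d -> 'I_M}.

(** The grid indexes both the points of the box and the frequencies; centring it keeps the latter in
    the range |theta| <= pi of the decay estimate. *)
Definition grid_pt (k : grid) : 'rV[int]_d := \row_j ((k j : nat)%:Z - m%:Z).

Definition freq (k : grid) : 'rV[R]_d := (2 * pi / M%:R) *: toR (grid_pt k).

(* The grid point congruent to x modulo M. *)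
Definition grid_rep (x : 'rV[int]_d) : grid :=
  [ffun j : 'I_d => inord (absz (((x 0%R j + m%:Z)%R %% M%:Z)%Z))].

Lemma grid_repP (x : 'rV[int]_d) (j : 'I_d) :
  exists z : int, x 0 j = grid_pt (grid_rep x) 0 j + z * M%:Z.
Proof.
exists ((x 0%R j + m%:Z)%R %/ M%:Z)%Z; rewrite mxE ffunE inordK.
  rewrite gez0_abs ?modz_ge0// [RHS]addrC addrA.
  by rewrite -divz_eq addrK.
by rewrite -ltz_nat gez0_abs ?modz_ge0// ltz_pmod.
Qed.

Lemma grid_pt_rep (x : 'rV[int]_d) : (forall j, `|x 0 j| <= m%:Z) -> grid_pt (grid_rep x) = x.
Proof.
move=> hx; apply/rowP => j; rewrite mxE ffunE.
have hj : 0 <= x 0 j + m%:Z < M%:Z.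
  have := hx j; rewrite ler_norml => /andP[h1 h2].
  by apply/andP; split; [rewrite -lerBlDr sub0r|lia].
rewrite modz_small// inordK; last by move: hj; lia.
by rewrite gez0_abs ?addrK//; case/andP: hj.
Qed.

Lemma grid_pt_inj : injective grid_pt.
Proof.
move=> k l /rowP kl; apply/ffunP => j; have := kl j; rewrite !mxE => /addIr [].
by move/val_inj.
Qed.

(** Real part of the discrete Dirichlet kernel, the sum of exp(i theta.x) over all frequencies;
    [kers] is its imaginary part. *)
Definition kerc (x : 'rV[int]_d) : R := \sum_k cos (dot (freq k) (toR x)).
Definition kers (x : 'rV[int]_d) : R := \sum_k sin (dot (freq k) (toR x)).

Definition shift_at (j : 'I_d) (k : grid) : grid :=
  [ffun i => if i == j then ordS (k i) else k i].

Lemma shift_at_inj j : injective (shift_at j).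
Proof.
move=> k l /ffunP kl; apply/ffunP => i; have := kl i; rewrite !ffunE.
by case: eqP => // _; exact: ordS_inj.
Qed.

Lemma M_gt0 : (0 : R) < M%:R. Proof. by rewrite ltr0n. Qed.

Lemma freq_shift (j : 'I_d) k (x : 'rV[int]_d) : exists z : int, dot (freq (shift_at j k)) (toR x) =
  dot (freq k) (toR x) + 2 * pi * ((x 0 j)%:~R / M%:R) + 2 * pi * z%:~R.
Proof.
have [z hz] : exists z : int, grid_pt (shift_at j k) 0 j = grid_pt k 0 j + 1 + z * M%:Z.
  rewrite !mxE ffunE eqxx /=.
  have [kj|kj] := ltnP (k j).+1 M.
    by exists 0; rewrite modn_small//; lia.
  (* Wrap-around: the coordinate jumps by 1 - M, which alters the phase by a multiple of 2 pi
     only. *)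
  exists (-1); have -> : (k j).+1 = M by apply/eqP; rewrite eqn_leq kj ltn_ord.
  rewrite modnn; have : (k j).+1 = M by apply/eqP; rewrite eqn_leq kj ltn_ord.
  lia.
exists (z * x 0 j); rewrite /freq !dotZl.
have -> : dot (toR (grid_pt (shift_at j k))) (toR x) =
   dot (toR (grid_pt k)) (toR x) + (1 + z%:~R * M%:R) * (x 0 j)%:~R :> R.
  rewrite /dot (bigD1 j)//= [in RHS](bigD1 j)//= [in RHS]addrAC; congr (_ + _).
    rewrite [toR _ 0 j]mxE hz [toR (grid_pt k) 0 j]mxE [toR x 0 j]mxE !intrD intrM.
    by ring.
  apply: eq_bigr => i ij; congr (_ * _).
  by rewrite !mxE ffunE (negbTE ij).
have := lt0r_neq0 M_gt0; rewrite rmorphM /= => M0.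
by field.
Qed.

(* Shifting the j-th frequency by one permutes the grid and rotates all the phases by
   the same angle, so the exponential sum vanishes unless this angle is trivial. *)
Lemma ker_shift (j : 'I_d) (x : 'rV[int]_d) : let a := 2 * pi * ((x 0 j)%:~R / M%:R) in
  kerc x = kerc x * cos a - kers x * sin a /\ kers x = kers x * cos a + kerc x * sin a.
Proof.
move=> a; rewrite {1}/kerc {2}/kers (reindex_inj (@shift_at_inj j)) /=.
rewrite [in X in _ /\ X](reindex_inj (@shift_at_inj j)) /=.
split.
  rewrite /kerc /kers !mulr_suml -sumrB; apply: eq_bigr => k _.
  have [z hz] := freq_shift j k x.
  by have [-> _] := cos_sin_congr hz; rewrite cosD.
rewrite /kerc /kers !mulr_suml -big_split; apply: eq_bigr => k _.
have [z hz] := freq_shift j k x.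
by have [_ ->] := cos_sin_congr hz; rewrite sinD [RHS]addrC /= addrC.
Qed.

Lemma kerc_eq0 (x : 'rV[int]_d) (j : 'I_d) : ~~ (M%:Z %| x 0%R j)%Z -> kerc x = 0.
Proof.
move=> Mx; have [hc hs] := ker_shift j x.
set a := 2 * pi * _ in hc hs.
have ca : cos a != 1.
  pose r := absz (x 0%R j %% M%:Z)%Z.
  have rE : (x 0%R j %% M%:Z)%Z = r%:Z by rewrite gez0_abs ?modz_ge0.
  have hr : (0 < r < M)%N.
    apply/andP; split; last by rewrite -ltz_nat -rE ltz_pmod.
    rewrite lt0n; apply: contra Mx => /eqP r0.
    by apply/dvdz_mod0P; rewrite rE r0.
  have := @cos_eq1_dvdn R M r hr.
  have hz : a = 2 * pi * (r%:R / M%:R) + 2 * pi * (x 0%R j %/ M%:Z)%Z%:~R.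
    have hx := divz_eq (x 0 j) M%:Z; rewrite rE in hx.
    set q := (x 0%R j %/ M%:Z)%Z in hx *.
    rewrite /a hx rmorphD rmorphM /=.
    by have M0 := lt0r_neq0 M_gt0; field.
  by have [-> _] := cos_sin_congr hz.
(* The relations say K = K exp(ia) for the complex kernel K; eliminating [kers] uses (1 - cos a)^2 +
   sin(a)^2 = 2 (1 - cos a). *)
have /eqP : kerc x * (1 - cos a) = 0.
  have h2 : kerc x * (1 - cos a) * 2 = kerc x * ((1 - cos a) ^+ 2 + (1 - cos a ^+ 2)) by ring.
  have s2 : 1 - cos a ^+ 2 = sin a ^+ 2 by rewrite -(cos2Dsin2 a) addrC addKr.
  have : kerc x * (1 - cos a) * 2 = 0.
    rewrite h2 s2.
    have e1 : kerc x * (1 - cos a) = - (kers x * sin a) by move: hc; clear; lra.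
    have e2 : kerc x * sin a = kers x * (1 - cos a) by move: hs; clear; lra.
    transitivity (kerc x * (1 - cos a) * (1 - cos a) + kerc x * sin a * sin a); first by ring.
    by rewrite e1 e2; ring.
  by move/eqP; rewrite mulf_eq0 pnatr_eq0 orbF => /eqP.
by rewrite mulf_eq0 subr_eq0 [1 == _]eq_sym (negbTE ca) orbF => /eqP.
Qed.

Lemma kerc_dvd (x : 'rV[int]_d) :
  (forall j, exists z : int, x 0 j = z * M%:Z) -> kerc x = #|grid|%:R.
Proof.
move=> hx; rewrite /kerc -[RHS]mulr1 mulr_natl -sumr_const; apply: eq_bigr => k _.
pose zx j := sval (cid (hx j)).
have zxP j : x 0 j = zx j * M%:Z by exact: svalP (cid (hx j)).
have h : dot (freq k) (toR x) = 0 + 2 * pi * (\sum_j (grid_pt k 0 j * zx j))%:~R :> R.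
  rewrite /freq dotZl add0r /dot rmorph_sum /= !mulr_sumr; apply: eq_bigr => j _.
  rewrite !mxE zxP !rmorphM /=.
  by have := lt0r_neq0 M_gt0 => M0; field.
by have [-> _] := cos_sin_congr h; rewrite cos0.
Qed.

Definition fcoefc (f : 'rV[int]_d -> R) (k : grid) : R :=
  #|grid|%:R^-1 * \sum_z f (grid_pt z) * cos (dot (freq k) (toR (grid_pt z))).
Definition fcoefs (f : 'rV[int]_d -> R) (k : grid) : R :=
  #|grid|%:R^-1 * \sum_z f (grid_pt z) * sin (dot (freq k) (toR (grid_pt z))).

Lemma card_grid_gt0 : (0 : R) < #|grid|%:R.
Proof. by rewrite ltr0n; apply/card_gt0P; exists [ffun=> ord0]. Qed.

(** The left side is the M-periodic extension of [f] restricted to the box. Exchanging the sums on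
    the right produces the kernel at x - z, which keeps only the grid point z congruent to x. *)
Lemma fourier_inversion (f : 'rV[int]_d -> R) (x : 'rV[int]_d) :
  f (grid_pt (grid_rep x)) = \sum_k (fcoefc f k * cos (dot (freq k) (toR x)) +
                                     fcoefs f k * sin (dot (freq k) (toR x))).
Proof.
have toRB (u v : 'rV[int]_d) : toR (u - v) = toR u - toR v :> 'rV[R]_d.
  by apply/rowP => j; rewrite !mxE rmorphB.
transitivity (#|grid|%:R^-1 * \sum_z f (grid_pt z) * kerc (x - grid_pt z)).
  rewrite (bigD1 (grid_rep x))//= kerc_dvd; last first.
    move=> j; have [z hz] := grid_repP x j; exists z.
    by rewrite !mxE hz mxE addrAC subrr add0r.
  rewrite big1 ?addr0 => [|z zx]; first by rewrite mulrC mulfK ?gt_eqF ?card_grid_gt0.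
  have [j zj] : exists j, z j != grid_rep x j.
    apply: contrapT => /forallNP h; move/eqP: zx; apply; apply/ffunP => j.
    by have /negP/negPn/eqP := h j.
  rewrite (@kerc_eq0 _ j) ?mulr0//.
  have [q hq] := grid_repP x j.
  rewrite 2!mxE hq addrAC rpredDr; last by rewrite dvdz_mull.
  rewrite !mxE opprB addrA subrK.
  move: zj (ltn_ord (z j)) (ltn_ord (grid_rep x j)).
  rewrite -val_eqE /=; move: (nat_of_ord (z j)) (nat_of_ord (grid_rep x j)) => a b ab aM bM.
  apply/negP => /dvdzP [q' hq'].
  have : q' = 0 by nia.
  by move=> q0; move: hq'; rewrite q0 mul0r => /eqP; lia.
rewrite /fcoefc /fcoefs.
under [RHS]eq_bigr => k _ do rewrite -!mulrA -mulrDr !mulr_suml -big_split /=.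
rewrite -mulr_sumr exchange_big /=; congr (_ * _).
apply: eq_bigr => z _; rewrite /kerc mulr_sumr; apply: eq_bigr => k _.
by rewrite toRB dotBr cosB; ring.
Qed.

End discrete_fourier.

(** * Averages over the cells of a box *)

Section cells.
Context {R : realType} {d : nat}.
Variables q m : nat.

Local Notation M := (m.*2.+1).
Local Notation Q := (q.*2.+1).
Local Notation grid := {ffun 'I_d -> 'I_M}.
Local Notation cells := {ffun 'I_d -> 'I_Q}.

(** On each axis, the point of index z sits at z + 1/2 in [0, M], which is cut into Q intervals of
    length M/Q: the index is the integer part of (z + 1/2) Q / M, freed of inner fractions. *)
Definition cell (z : grid) : cells :=
  [ffun j : 'I_d => inord (((z j).*2.+1 * Q) %/ M.*2) : 'I_Q].

Definition cell_center (c : cells) (j : 'I_d) : R := (c j)%:R - q%:R.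
Definition cell_lo (c : cells) (j : 'I_d) : R := cell_center c j - 2^-1.
Definition cell_hi (c : cells) (j : 'I_d) : R := cell_center c j + 2^-1.
Definition cell_size : R := M%:R / Q%:R.

(* The cells overlap in no lattice point: M and Q being odd, no wall contains one. *)
Lemma cell_div (z c : nat) : (z < M)%N -> (c < Q)%N ->
  ((z.*2.+1 * Q) %/ M.*2 == c)%N = (c * M.*2 <= z.*2.+1 * Q <= c.+1 * M.*2)%N.
Proof.
move=> zM cQ; have M0 : (0 < M.*2)%N by rewrite double_gt0.
have hodd : (z.*2.+1 * Q)%N != (c.+1 * M.*2)%N.
  apply/eqP => /(congr1 odd); rewrite !oddM /= !odd_double /=.
  by rewrite andbF.
rewrite [(_ <= c.+1 * _)%N]leq_eqVlt (negbTE hodd)/=.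
by rewrite eqn_leq -ltnS ltn_divLR// leq_divRL// andbC.
Qed.

(** Multiplying by 2Q and adding MQ turns the real bounds of a centred cell into the integer ones of
    [cell_div], for the index v + m. *)
Lemma cell_ineq (v : int) (c : nat) :
  ((c%:R - q%:R - 2^-1) * cell_size <= v%:~R <= (c%:R - q%:R + 2^-1) * cell_size) =
  (c%:Z * M.*2%:Z <= (2 * (v + m%:Z) + 1) * Q%:Z <= c.+1%:Z * M.*2%:Z).
Proof.
have Q0 : (0 : R) < Q%:R by rewrite ltr0n.
have hM : M%:R = 2 * m%:R + 1 :> R by rewrite -natr1 -mul2n natrM.
have hQ : Q%:R = 2 * q%:R + 1 :> R by rewrite -natr1 -mul2n natrM.
have hM2 : M.*2%:R = 2 * (2 * m%:R + 1) :> R by rewrite -mul2n natrM hM.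
rewrite -!(ler_int R) !rmorphM !rmorphD !rmorphM !rmorphD /= -!pmulrn hM2.
rewrite (_ : c.+1%:R = c%:R + 1 :> R); last by rewrite natr1.
rewrite /cell_size !mulrA ler_pdivrMr// ler_pdivlMr// hM hQ.
set x := (v%:~R : R); set a := (m%:R : R); set b := (q%:R : R); set e := (c%:R : R).
by congr (_ && _); apply/idP/idP; lra.
Qed.

Lemma cell_eqP (z : grid) (c : cells) : reflect
  (box_set (fun j => cell_lo c j * cell_size) (fun j => cell_hi c j * cell_size) (grid_pt z))
  (cell z == c).
Proof.
have lt_cell j : (((z j).*2.+1 * Q) %/ M.*2 < Q)%N.
  rewrite ltn_divLR ?double_gt0// mulnC ltn_pmul2l//.
  by case: (z j) => n /=; rewrite -!muln2; lia.
have E j : (cell z j == c j) =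
    ((c j)%:Z * M.*2%:Z <= (2 * (grid_pt z 0 j + m%:Z) + 1) * Q%:Z <= (c j).+1%:Z * M.*2%:Z).
  rewrite -val_eqE ffunE /= inordK// cell_div ?ltn_ord// mxE subrK.
  by congr (_ && _); lia.
apply: (iffP eqP) => [zc j|h].
  by rewrite /cell_lo /cell_hi cell_ineq -E zc.
by apply/ffunP => j; apply/eqP; rewrite E -cell_ineq; exact: h.
Qed.

Lemma cell_box_in_grid (c : cells) (v : 'rV[int]_d) :
  box_set (fun j => cell_lo c j * cell_size) (fun j => cell_hi c j * cell_size) v ->
  exists z : grid, grid_pt z = v.
Proof.
move=> hv; exists (grid_rep m v); apply: grid_pt_rep => j.
have := hv j; rewrite /cell_lo /cell_hi cell_ineq => /andP[h1 h2].
have cQ : (c j)%:Z <= q%:Z * 2 by have := ltn_ord (c j); lia.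
rewrite ler_norml; apply/andP; split.
  have : 0 <= (2 * (v 0 j + m%:Z) + 1) * Q%:Z by rewrite (le_trans _ h1).
  rewrite pmulr_lge0//; lia.
have : (2 * (v 0 j + m%:Z) + 1) * Q%:Z <= M.*2%:Z * Q%:Z.
  by rewrite (le_trans h2)// mulrC ler_wpM2l//; lia.
rewrite ler_pM2r//; lia.
Qed.

(** Links the combinatorial cells to the scaled boxes of [global_average]: the corners are fixed and
    [cell_size] is the scale L. *)
Lemma cell_sum (G : 'rV[int]_d -> R) (c : cells) :
  \sum_(z | cell z == c) G (grid_pt z) =
  \sum_(v <- box (fun j => cell_lo c j * cell_size) (fun j => cell_hi c j * cell_size)) G v.
Proof.
rewrite -big_filter -(big_map (@grid_pt d m) predT G).
apply: perm_big; apply: uniq_perm.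
- rewrite map_inj_uniq; last exact: grid_pt_inj.
  by rewrite filter_uniq// index_enum_uniq.
- exact: fset_uniq.
move=> v; apply/mapP/idP.
  move=> [z]; rewrite mem_filter => /andP[/cell_eqP zc _] ->.
  by rewrite in_fset_set ?inE//; exact: finite_box_set.
rewrite in_fset_set; last exact: finite_box_set.
rewrite inE => hv; have [z zv] := cell_box_in_grid hv.
by exists z => //; rewrite mem_filter mem_index_enum andbT; apply/cell_eqP; rewrite zv.
Qed.

(** A weighted mean of the absolute cell averages of [G], the weight of a cell being its share of
    the grid points. *)
Definition cell_defect (G : 'rV[int]_d -> R) : R :=
  #|grid|%:R^-1 * \sum_c `|\sum_(z | cell z == c) G (grid_pt z)|.

Definition norm1 (k : grid) : R := \sum_j `|(grid_pt k 0 j)%:~R|.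

(** Freezing the phase at the centre of each cell costs at most (2 pi / M) |k|_1 (M / 2Q) per point;
    the wave is then constant on cells and only cell sums of [G] remain. Here [h] stands for cos or
    sin. *)
Lemma fcoef_bound (G : 'rV[int]_d -> R) (B : R) (h : R -> R) k :
  (forall x, `|G x| <= B) -> (forall x, `|h x| <= 1) ->
  (forall x y, `|h x - h y| <= `|x - y|) ->
  `|#|grid|%:R^-1 * \sum_(z : grid) G (grid_pt z) * h (dot (freq k) (toR (grid_pt z)))| <=
  B * (pi * norm1 k / Q%:R) + cell_defect G.
Proof.
move=> hB h1 hlip.
have g0 : (0 : R) < #|grid|%:R by exact: card_grid_gt0.
have Q0 : (0 : R) < Q%:R by rewrite ltr0n.
have M0 : (0 : R) < M%:R by rewrite ltr0n.
pose y (c : cells) : 'rV[R]_d := \row_j (cell_center c j * cell_size).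
pose e := pi * norm1 k / Q%:R.
have near z : `|dot (freq k) (toR (grid_pt z)) - dot (freq k) (y (cell z))| <= e.
  rewrite -dotBr (le_trans (ler_norm_sum _ _ _))//.
  rewrite /e /norm1 mulr_sumr mulr_suml ler_sum// => j _.
  have /cell_eqP/(_ j) := eqxx (cell z).
  rewrite /cell_lo /cell_hi => hz.
  have hd : `|(toR (grid_pt z) - y (cell z)) 0 j| <= 2^-1 * cell_size.
    have -> : (toR (grid_pt z) - y (cell z)) 0 j =
        (grid_pt z 0 j)%:~R - cell_center (cell z) j * cell_size by rewrite !mxE.
    move: hz; rewrite ler_norml.
    by set u := cell_center _ _; set s := cell_size; lra.
  rewrite normrM mxE normrM [toR _ _ _]mxE (ger0_norm (_ : 0 <= 2 * pi / M%:R)); last first.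
    by rewrite divr_ge0 ?mulr_ge0 ?pi_ge0.
  rewrite (le_trans (ler_wpM2l _ hd)) ?mulr_ge0 ?divr_ge0 ?pi_ge0//.
  rewrite /cell_size le_eqVlt; apply/orP; left; apply/eqP.
  have M1 := lt0r_neq0 M0; have Q1 := lt0r_neq0 Q0.
  move: (_%:~R) M1 Q1 => x; move: (M%:R : R) (Q%:R : R) => a b a0 b0.
  by field; rewrite a0 b0.
have B0 : 0 <= B by exact: le_trans (hB 0).
rewrite normrM ger0_norm ?invr_ge0 ?(ltW g0)//.
have -> : B * (pi * norm1 k / Q%:R) + cell_defect G =
  #|grid|%:R^-1 * (\sum_(z : grid) B * e + \sum_c `|\sum_(z | cell z == c) G (grid_pt z)|).
  rewrite sumr_const -[X in _^-1 * (X + _)]mulr_natl mulrDr mulKf//.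
  exact: lt0r_neq0.
rewrite ler_pM2l ?invr_gt0//.
have -> : \sum_(z : grid) G (grid_pt z) * h (dot (freq k) (toR (grid_pt z))) =
  \sum_(z : grid) G (grid_pt z) * (h (dot (freq k) (toR (grid_pt z))) -
    h (dot (freq k) (y (cell z)))) +
  \sum_c h (dot (freq k) (y c)) * \sum_(z | cell z == c) G (grid_pt z).
  have -> : \sum_c h (dot (freq k) (y c)) * \sum_(z | cell z == c) G (grid_pt z) =
    \sum_(z : grid) G (grid_pt z) * h (dot (freq k) (y (cell z))).
    rewrite (partition_big cell xpredT)//=; apply: eq_bigr => c _.
    by rewrite mulr_sumr; apply: eq_bigr => z /eqP <-; rewrite mulrC.
  by rewrite -big_split; apply: eq_bigr => z _ /=; ring.
rewrite (le_trans (ler_normD _ _))// lerD//.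
  rewrite (le_trans (ler_norm_sum _ _ _))// ler_sum// => z _.
  by rewrite normrM ler_pM// (le_trans (hlip _ _)).
rewrite (le_trans (ler_norm_sum _ _ _))// ler_sum// => c _.
by rewrite normrM ler_piMl.
Qed.

End cells.

Section defect.
Context {R : realType} {d : nat}.

Lemma sumr_const_seq (T : Type) (s : seq T) (c : R) :
  \sum_(v <- s) c = (size s)%:R * c.
Proof. by rewrite big_const_seq iter_addr_0 mulr_natl; congr (_ *+ _); exact: count_predT. Qed.

Lemma cell_defect_cvg (q : nat) (F : 'rV[int]_d -> R) (Fbar : R) :
  global_average F Fbar ->
  (fun m => cell_defect q m (fun x => F x - Fbar)) @ \oo --> (0 : R).
Proof.
move=> hF; have Q0 : (0 : R) < q.*2.+1%:R by rewrite ltr0n.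
pose W m : R := \sum_(c : {ffun 'I_d -> 'I_(q.*2.+1)})
  `|average F (box (fun j => cell_lo c j * cell_size q m : R)
                   (fun j => cell_hi c j * cell_size q m : R)) - Fbar|.
have size_cvg : (fun m => cell_size q m : R) @ \oo --> +oo.
  apply/cvgryPge => A; near=> m.
  rewrite /cell_size ler_pdivlMr//.
  rewrite (le_trans (ler_norm _))//; set x := `|_|.
  rewrite (le_trans (ltW (truncnS_gt _)))//.
  have hm : (Num.truncn x <= m)%N by near: m; exact: nbhs_infty_ge.
  by rewrite ler_nat ltnS (leq_trans hm)// -addnn leq_addr.
have Wcvg : W @ \oo --> (0 : R).
  rewrite -[X in _ --> X](_ : \sum_(c : {ffun 'I_d -> 'I_(q.*2.+1)}) `|Fbar - Fbar| = _);
    last first.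
    by rewrite big1// => c _; rewrite subrr normr0.
  apply: cvg_big => [|c _]; first exact: add_continuous.
  apply: cvg_norm; apply: cvgB; last exact: cvg_cst.
  have hlt j : cell_lo c j < cell_hi c j :> R.
    by rewrite /cell_lo /cell_hi ltrD2l gtrN// invr_gt0.
  exact: (cvg_comp _ _ size_cvg (hF _ _ hlt)).
apply: (@squeeze_cvgr _ _ _ _ (fun=> 0) W) => //; last exact: cvg_cst.
apply: nearW => m; apply/andP; split.
  by rewrite mulr_ge0 ?invr_ge0// sumr_ge0.
rewrite /cell_defect mulr_sumr ler_sum// => c _.
set a := fun j => cell_lo c j * cell_size q m.
set b := fun j => cell_hi c j * cell_size q m.
have g0 : (0 : R) < #|{ffun 'I_d -> 'I_(m.*2.+1)}|%:R by exact: card_grid_gt0.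
(* Bounding the weight of each cell by 1 is enough, the number of cells being fixed. *)
have hcard : (#|` box a b| <= #|{ffun 'I_d -> 'I_(m.*2.+1)}|)%N.
  have hsum := @cell_sum R d q m (fun=> 1) c.
  rewrite -(ler_nat R); move: hsum.
  rewrite -/a -/b sumr_const_seq mulr1 => <-.
  rewrite -[leRHS]mulr1 mulr_natl -sumr_const [leRHS](bigID (fun z => cell q z == c))/=.
  by rewrite lerDl sumr_ge0.
have /= -> := @cell_sum R d q m (fun x => F x - Fbar) c.
rewrite -/a -/b ler_pdivrMl//.
have [b0|b0] := posnP #|` box a b|.
  rewrite (_ : box a b = fset0) ?big_seq_fset0 ?normr0 ?mulr_ge0//.
  by apply/eqP; rewrite -cardfs_eq0 b0.
have bR : (0 : R) < #|` box a b|%:R by rewrite ltr0n.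
have -> : \sum_(v <- box a b) (F v - Fbar) = #|` box a b|%:R * (average F (box a b) - Fbar).
  rewrite mulrBr /average mulrA divff ?mul1r ?gt_eqF// sumrB.
  by rewrite sumr_const_seq.
by rewrite normrM ger0_norm// ler_wpM2r// ler_nat.
Unshelve. all: by end_near. Qed.

End defect.

(** * Sums over the frequencies, uniformly in the size of the box *)

Section grid_sums.
Context {R : realType} {d : nat}.
Variable m : nat.
Local Notation M := (m.*2.+1).
Local Notation grid := {ffun 'I_d -> 'I_M}.

Lemma geometric_sum_le (r : R) n : 0 <= r < 1 -> \sum_(0 <= i < n) r ^+ i <= (1 - r)^-1.
Proof.
move=> /andP[r0 r1]; have r1' : 0 < 1 - r by rewrite subr_gt0.
rewrite -[leRHS]mul1r ler_pdivlMr//.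
suff -> : (\sum_(0 <= i < n) r ^+ i) * (1 - r) = 1 - r ^+ n by rewrite gerBl exprn_ge0.
elim: n => [|n ih]; first by rewrite big_geq// mul0r expr0 subrr.
by rewrite big_nat_recr//= mulrDl ih exprS; ring.
Qed.

Lemma centered_geometric_sum_le (r : R) : 0 <= r < 1 ->
  \sum_(a < M) r ^+ absz ((a : nat)%:Z - m%:Z) <= 2 / (1 - r).
Proof.
move=> r01; have [r0 r1] := andP r01.
rewrite -(big_mkord xpredT (fun a => r ^+ absz (a%:Z - m%:Z))).
rewrite (@big_cat_nat _ _ _ m)//=; last by lia.
rewrite (_ : 2 / (1 - r) = (1 - r)^-1 + (1 - r)^-1); last by ring.
apply: lerD.
  rewrite big_nat_rev/= add0n.
  apply: le_trans (geometric_sum_le m r01).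
  rewrite big_nat [leRHS]big_nat; apply: ler_sum => i /andP[_ im].
  rewrite (_ : absz _ = i.+1); last by lia.
  by rewrite exprS ler_piMl ?exprn_ge0// ltW.
rewrite -{1}[m]add0n big_addn.
apply: le_trans (geometric_sum_le (M - m) r01).
apply: ler_sum => i _; rewrite (_ : absz _ = i)//; lia.
Qed.

Lemma norm1_ge0 (k : grid) : 0 <= norm1 k :> R.
Proof. by apply: sumr_ge0. Qed.

(** The exponential factors over the coordinates, so the sum is the d-th power of a two-sided
    geometric sum; the bound is free of m. *)
Lemma grid_exp_sum (b : R) : 0 < b ->
  \sum_(k : grid) expR (- (b * norm1 k)) <= (2 / (1 - expR (- b))) ^+ d.
Proof.
move=> b0; set r := expR (- b).
have r01 : 0 <= r < 1 by rewrite expR_ge0 expR_lt1 oppr_lt0.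
have E (k : grid) : expR (- (b * norm1 k)) = \prod_j r ^+ absz ((k j : nat)%:Z - m%:Z).
  rewrite /norm1 mulr_sumr -sumrN expR_sum; apply: eq_bigr => j _.
  by rewrite -expRM_natl natr_absz mxE intr_norm mulrN mulrC.
rewrite (eq_bigr _ (fun k _ => E k)).
rewrite -(bigA_distr_bigA (fun (j : 'I_d) (a : 'I_M) => r ^+ absz ((a : nat)%:Z - m%:Z))).
rewrite prodr_const card_ord lerXn2r// ?nnegrE.
- by rewrite sumr_ge0// => a _; rewrite exprn_ge0// expR_ge0.
- by rewrite divr_ge0// subr_ge0 ltW//; case/andP: r01.
- exact: centered_geometric_sum_le.
Qed.

Lemma freq_norm_ge (k : grid) j : (2 * pi / M%:R) * `|(grid_pt k 0 j)%:~R| <= `|freq k : 'rV[R]_d|.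
Proof.
have h0 : 0 <= 2 * pi / M%:R :> R by rewrite divr_ge0 ?mulr_ge0 ?pi_ge0.
rewrite /freq normrZ ger0_norm// ler_wpM2l//.
by have := norm_coord_le (toR (grid_pt k) : 'rV[R]_d) j; rewrite mxE.
Qed.

Lemma freq_norm_le (k : grid) : `|freq k : 'rV[R]_d| <= pi.
Proof.
have h0 : 0 <= 2 * pi / M%:R :> R by rewrite divr_ge0 ?mulr_ge0 ?pi_ge0.
rewrite /freq normrZ ger0_norm// mulrAC ler_pdivrMr ?ltr0n//.
rewrite [2 * _]mulrC -mulrA ler_pM2l ?pi_gt0//.
rewrite -ler_pdivlMl//; apply: norm_le_coord; first by rewrite mulr_ge0 ?invr_ge0.
move=> j; rewrite mxE ler_pdivlMl//.
have h : 2 * `|grid_pt k 0 j| <= M%:Z.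
  by rewrite mxE; case: (k j) => a /= aM; lia.
rewrite -(ler_int R) in h; move: h.
by rewrite rmorphM /= intr_norm -pmulrn.
Qed.

(** A coordinate u of k forces |theta| >= u / (K N^(1/alpha)), so |theta|^alpha has a factor 1/N,
    which t >= e N cancels. Adding up the d coordinates costs the division by [d.+1]. *)
Lemma freq_weight (k : grid) (alpha c K N e t : R) : 1 <= alpha -> 0 < c -> 0 < K -> 0 < N ->
  0 < e -> M%:R <= K * N `^ alpha^-1 -> e * N <= t ->
  (c * e * K `^ (- alpha) / d.+1%:R) * norm1 k <= c * t * `|freq k : 'rV[R]_d| `^ alpha.
Proof.
move=> al1 c0 K0 N0 e0 hM ht.
have al0 : 0 < alpha by rewrite (lt_le_trans _ al1).
have t0 : 0 <= t by rewrite (le_trans _ ht)// mulr_ge0 ?ltW.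
set s := N `^ alpha^-1 in hM; have s0 : 0 < s by rewrite powR_gt0.
have sa : s `^ alpha = N by rewrite /s -powRrM mulVf ?gt_eqF// powRr1// ltW.
set x := `|freq k : 'rV[R]_d|.
have coord j : e * K `^ (- alpha) * `|(grid_pt k 0 j)%:~R| <= t * x `^ alpha.
  set u := `|(grid_pt k 0 j)%:~R|.
  (* True because u is the absolute value of an integer and alpha >= 1; it trades the power for a
     linear weight, whose exponential factors. *)
  have u1 : u <= u `^ alpha.
    have [/eqP u0|u0] := boolP (grid_pt k 0 j == 0).
      by rewrite /u u0 normr0 powR_ge0.
    have : 1 <= u.
      by rewrite /u -intr_norm -[1]/(1%:~R) ler_int -gtz0_ge1 normr_gt0.
    by move=> u1; rewrite -[leLHS]powRr1 ?ler_powR// (le_trans ler01).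
  have Ks0 : 0 < K * s by rewrite mulr_gt0.
  have xu : u / (K * s) <= x.
    apply: le_trans (freq_norm_ge k j); rewrite -/u mulrC ler_wpM2r// ?normr_ge0//.
    rewrite (@le_trans _ _ M%:R^-1)//.
      by rewrite lef_pV2 ?posrE// ltr0n.
    by rewrite ler_peMl ?invr_ge0//; have := pi_ge2 R; lra.
  have xa : u `^ alpha * (K `^ (- alpha) / N) <= x `^ alpha.
    have <- : (u / (K * s)) `^ alpha = u `^ alpha * (K `^ (- alpha) / N).
      rewrite powRM ?invr_ge0 ?(ltW Ks0) ?normr_ge0//; congr (_ * _).
      rewrite -powR_inv1 ?(ltW Ks0)// -powRrM mulN1r.
      by rewrite powRM ?(ltW K0) ?(ltW s0)// [s `^ _]powRN sa.
    apply: ge0_ler_powR (ltW al0) _ _ _ _ xu; rewrite nnegrE ?normr_ge0//.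
    by apply: divr_ge0; [exact: normr_ge0|exact: ltW].
  rewrite (@le_trans _ _ (e * N * (u `^ alpha * (K `^ (- alpha) / N))))//.
    rewrite (_ : e * N * _ = e * K `^ (- alpha) * u `^ alpha * (N / N)); last by ring.
    rewrite divff ?gt_eqF// mulr1 ler_wpM2l// mulr_ge0 ?powR_ge0//.
    exact: ltW.
  by rewrite ler_pM ?mulr_ge0 ?invr_ge0 ?powR_ge0 ?(ltW N0) ?(ltW e0).
have hsum : e * K `^ (- alpha) * norm1 k <= d.+1%:R * (t * x `^ alpha).
  rewrite /norm1 mulr_sumr.
  rewrite (@le_trans _ _ (\sum_(j < d) t * x `^ alpha))//; first exact: ler_sum.
  rewrite sumr_const card_ord -[leLHS]mulr_natl ler_wpM2r ?ler_nat//.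
  by rewrite mulr_ge0 ?powR_ge0.
rewrite [leLHS](_ : _ = c * (e * K `^ (- alpha) * norm1 k / d.+1%:R)); last by ring.
by rewrite -[leRHS]mulrA ler_pM2l// ler_pdivrMr// [leRHS]mulrC.
Qed.

(** Half of the exponent absorbs the linear factor, by x exp(- kappa x / 2) <= 2 / kappa; the other
    half is summed. *)
Lemma weighted_sum_bound (c1 c2 kappa : R) : 0 <= c1 -> 0 <= c2 -> 0 < kappa ->
  \sum_(k : grid) (c1 * norm1 k + c2) * expR (- (kappa * norm1 k)) <=
  (c1 * (2 / kappa) + c2) * (2 / (1 - expR (- (kappa / 2)))) ^+ d.
Proof.
move=> c10 c20 k0; have k20 : 0 < kappa / 2 by rewrite divr_gt0.
apply: le_trans (ler_wpM2l _ (grid_exp_sum k20)); last first.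
  by rewrite addr_ge0// mulr_ge0// divr_ge0// ltW.
rewrite mulr_sumr ler_sum// => k _.
set x := norm1 k; have x0 : 0 <= x by exact: norm1_ge0.
have -> : expR (- (kappa * x)) = expR (- (kappa / 2 * x)) * expR (- (kappa / 2 * x)).
  by rewrite -expRD; congr expR; field.
rewrite mulrA ler_wpM2r ?expR_ge0//.
rewrite mulrDl lerD//; last first.
  rewrite ler_piMr// -[leRHS]expR0 ler_expR oppr_le0 mulr_ge0// ltW//.
rewrite -mulrA ler_wpM2l// expRN ler_pdivrMr ?expR_gt0//.
rewrite -ler_pdivrMl ?divr_gt0// invf_div.
by rewrite (le_trans _ (expR_ge1Dx _))// mulrC ler_wpDl// mulrC.
Qed.

End grid_sums.

(** * Covariances along the walk *)

Section covariance.
Context {R : realType} {disp : measure_display} {Omega : measurableType disp}.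
Variable P : probability Omega R.
Context {d : nat}.
Variable X : nat -> Omega -> 'rV[int]_d.
Hypothesis X_iid : iid P X.
Variables (alpha c : R).
Hypothesis alpha_gt1 : 1 < alpha.
Hypothesis c_gt0 : 0 < c.
Hypothesis decay : forall t, `|t| <= pi -> rho P X t <= expR (- (c * `|t| `^ alpha)).
Variables (G : 'rV[int]_d -> R) (B : R).
Hypothesis B_gt0 : 0 < B.
Hypothesis G_le : forall x, `|G x| <= B.

Lemma covariance_wave n k t : `|t| <= pi ->
  `|\int[P]_w (G (walk X n w) * cos (dot t (toR (walk X (n + k) w))))| <=
    2 * B * expR (- (c / 2 * k%:R * `|t| `^ alpha)) /\
  `|\int[P]_w (G (walk X n w) * sin (dot t (toR (walk X (n + k) w))))| <=
    2 * B * expR (- (c / 2 * k%:R * `|t| `^ alpha)).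
Proof.
move=> tpi; have := chf_walk X_iid n k t G_le.
set a := \int[P]_w _; set b := \int[P]_w _; set a0 := \int[P]_w _; set b0 := \int[P]_w _.
move=> hab.
have bG : bmf (fun w => G (walk X n w)) := bmf_walk X_iid n G_le.
have md l : measurable_fun setT (fun w => dot t (toR (walk X l w)) : R).
  exact: (measurable_fun_walk X_iid l (fun x => dot t (toR x))).
have ha0 : `|a0| <= B.
  apply: norm_mean_le; first by apply: bmfM => //; exact: bmf_cos.
  by move=> w; rewrite normrM -[leRHS]mulr1 ler_pM// norm_cos_le1.
have hb0 : `|b0| <= B.
  apply: norm_mean_le; first by apply: bmfM => //; exact: bmf_sin.
  by move=> w; rewrite normrM -[leRHS]mulr1 ler_pM// norm_sin_le1.
have sq (u v : R) : 0 <= v -> `|u| <= v -> u ^+ 2 <= v ^+ 2.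
  by move=> v0 uv; rewrite -[u ^+ 2]real_normK ?num_real// ler_pXn2r ?nnegrE.
have B0 := ltW B_gt0.
set e := expR _.
(* [rho] is a squared modulus, so the bound on the modulus has half the rate. *)
have he : expR (- (c * `|t| `^ alpha)) ^+ k = e ^+ 2.
  by rewrite /e -!expRM_natl; congr expR; field.
have e0 : 0 <= e by exact: expR_ge0.
have hsum : a ^+ 2 + b ^+ 2 <= (2 * B * e) ^+ 2.
  rewrite hab (@le_trans _ _ ((B ^+ 2 + B ^+ 2) * e ^+ 2))//.
    rewrite ler_pM ?addr_ge0 ?sqr_ge0 ?exprn_ge0 ?rho_ge0//; first by rewrite lerD// sq.
    by rewrite -he lerXn2r ?nnegrE ?rho_ge0 ?expR_ge0// decay.
  rewrite !exprMn ler_wpM2r ?exprn_ge0//.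
  by have := sqr_ge0 B; set x := B ^+ 2; lra.
have fin (u v : R) : 0 <= v -> u ^+ 2 <= v ^+ 2 -> `|u| <= v.
  by move=> v0; rewrite -[u ^+ 2]real_normK ?num_real// ler_pXn2r ?nnegrE.
split; apply: fin; rewrite ?mulr_ge0//; apply: le_trans hsum.
  by rewrite lerDl sqr_ge0.
by rewrite lerDr sqr_ge0.
Qed.

(** Periodisation changes [G] only outside the box, where some integer coordinate is at least m + 1
    in absolute value and the minimum is 1. *)
Lemma norm_fourier_tail m (x : 'rV[int]_d) :
  `|G x - G (grid_pt (grid_rep m x))| <= 2 * B * Num.min 1 (m.+1%:R^-1 * `|toR x : 'rV[R]_d|).
Proof.
have [h|/existsNP [j /negP hj]] := pselect (forall j, `|x 0 j| <= m%:Z).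
  by rewrite grid_pt_rep// subrr normr0 !mulr_ge0 ?(ltW B_gt0)//.
rewrite min_l.
  by rewrite mulr1 (le_trans (ler_normB _ _))// (_ : 2 * B = B + B) ?lerD//; ring.
rewrite -[leLHS](mulVf (_ : m.+1%:R != 0 :> R))// ler_wpM2l ?invr_ge0//.
apply: le_trans (norm_coord_le _ j); rewrite mxE -intr_norm.
rewrite -[_.+1%:R]/((m.+1%:Z)%:~R) ler_int; lia.
Qed.

Lemma covariance_bound n k m :
  `|\int[P]_w (G (walk X n w) * G (walk X (n + k) w))| <=
  \sum_(xi : {ffun 'I_d -> 'I_(m.*2.+1)})
    (`|fcoefc G xi| + `|fcoefs G xi|) *
    (2 * B * expR (- (c / 2 * k%:R * `|freq xi : 'rV[R]_d| `^ alpha))) +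
  2 * B ^+ 2 * \int[P]_w Num.min 1 (m.+1%:R^-1 * `|toR (walk X (n + k) w) : 'rV[R]_d|).
Proof.
have B0 := ltW B_gt0.
pose S := walk X (n + k).
pose H x := G (grid_pt (grid_rep m x)).
have H_le x : `|H x| <= B by exact: G_le.
have bGn : bmf (fun w => G (walk X n w)) := bmf_walk X_iid n G_le.
have bG : bmf (fun w => G (S w)) := bmf_walk X_iid _ G_le.
have bH : bmf (fun w => H (S w)) := bmf_walk X_iid _ H_le.
have md t : measurable_fun setT (fun w => dot t (toR (S w)) : R).
  exact: (measurable_fun_walk X_iid (n + k) (fun x => dot t (toR x))).
have bcos t : bmf (fun w => G (walk X n w) * cos (dot t (toR (S w)))).
  by apply: bmfM => //; exact: bmf_cos.
have bsin t : bmf (fun w => G (walk X n w) * sin (dot t (toR (S w)))).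
  by apply: bmfM => //; exact: bmf_sin.
have bmin : bmf (fun w => Num.min 1 (m.+1%:R^-1 * `|toR (S w) : 'rV[R]_d|)).
  apply: bmf_min1 => [|w]; last by rewrite mulr_ge0 ?invr_ge0.
  exact: (measurable_fun_walk X_iid (n + k) (fun x => m.+1%:R^-1 * `|toR x : 'rV[R]_d|)).
have -> : \int[P]_w (G (walk X n w) * G (S w)) =
    \int[P]_w (G (walk X n w) * H (S w)) + \int[P]_w (G (walk X n w) * (G (S w) - H (S w))).
  rewrite -meanD; [|exact: bmfM|by apply: bmfM => //; exact: bmfB].
  by apply: eq_Rintegral => w _; ring.
rewrite (le_trans (ler_normD _ _))// lerD//; last first.
  apply: (le_trans (le_norm_mean P (bmfM bGn (bmfB bG bH)))).
  rewrite -meanZ//; apply: le_mean => [||w].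
  - exact: (bmf_norm (bmfM bGn (bmfB bG bH))).
  - exact: bmfZ.
  rewrite normrM (_ : 2 * B ^+ 2 = B * (2 * B)); last by ring.
  by rewrite -mulrA ler_pM//; exact: norm_fourier_tail.
have -> : \int[P]_w (G (walk X n w) * H (S w)) =
  \sum_(xi : {ffun 'I_d -> 'I_(m.*2.+1)})
   (fcoefc G xi * \int[P]_w (G (walk X n w) * cos (dot (freq xi) (toR (S w)))) +
    fcoefs G xi * \int[P]_w (G (walk X n w) * sin (dot (freq xi) (toR (S w))))).
  under [RHS]eq_bigr => xi _ do (rewrite -!meanZ//; rewrite -meanD; [|exact: bmfZ|exact: bmfZ]).
  rewrite -mean_sum; last by move=> xi; apply: bmfD; exact: bmfZ.
  apply: eq_Rintegral => w _; rewrite /H fourier_inversion mulr_sumr.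
  by apply: eq_bigr => xi _; ring.
rewrite (le_trans (ler_norm_sum _ _ _))// ler_sum// => xi _.
have [hc hs] := covariance_wave n k (freq_norm_le xi).
rewrite (le_trans (ler_normD _ _))// mulrDl.
by apply: lerD; rewrite normrM ler_wpM2l.
Qed.

Hypothesis tight : forall e : R, 0 < e -> exists2 eta, 0 < eta &
  \forall n \near \oo, \int[P]_w (Num.min 1 (eta * `|scaled_walk X alpha n w|)) < e.
Hypothesis defect : forall q, (fun m => cell_defect q m G) @ \oo --> (0 : R).

(** Half of [tau] goes to the mass outside the box, a quarter to freezing the waves on cells, a
    quarter to the cell averages. [eta], [K], [kap] and [q] are fixed before N, so [defect] is used
    for a single subdivision. *)
Lemma covariance_small (tau e : R) : 0 < tau -> 0 < e -> exists N0, forall N n k,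
  (N0 <= N)%N -> (n + k <= N)%N -> e * N%:R <= k%:R ->
  `|\int[P]_w (G (walk X n w) * G (walk X (n + k) w))| <= tau.
Proof.
move=> tau0 e0; have B0 := ltW B_gt0; have al0 : 0 < alpha by rewrite (lt_trans _ alpha_gt1).
have e10 : 0 < tau / (4 * B ^+ 2) by rewrite divr_gt0// mulr_gt0// exprn_gt0.
have [eta eta0 [n1 _ hn1]] := tight e10.
(* With m <= s / eta and s = N^(1/alpha) >= 1, the side 2m + 1 is at most K s. *)
pose K : R := 2 / eta + 1.
have K0 : 0 < K by rewrite addr_gt0// divr_gt0.
pose kap : R := c / 2 * e * K `^ (- alpha) / d.+1%:R.
have c20 : 0 < c / 2 by rewrite divr_gt0.
have kap0 : 0 < kap by rewrite divr_gt0// !mulr_gt0// powR_gt0.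
pose S : R := (2 / (1 - expR (- (kap / 2)))) ^+ d.
have S0 : 0 < S.
  by rewrite exprn_gt0// divr_gt0// subr_gt0 expR_lt1 oppr_lt0 divr_gt0.
pose C : R := 4 * B ^+ 2 * pi * (2 / kap) * S.
pose q := Num.truncn (C / (tau / 4)).
have C0 : 0 <= C.
  apply: mulr_ge0 (ltW S0); apply: mulr_ge0; last by rewrite divr_ge0 ?(ltW kap0).
  by rewrite !mulr_ge0 ?sqr_ge0 ?pi_ge0.
have tau40 : 0 < tau / 4 by rewrite divr_gt0.
have hq : C / q.*2.+1%:R <= tau / 4.
  rewrite ler_pdivrMr// mulrC -ler_pdivrMr//.
  rewrite (le_trans (ltW (truncnS_gt _)))// ler_nat ltnS -addnn leq_addr//.
have w0 : 0 < tau / 4 / (4 * B * S) by rewrite divr_gt0// !mulr_gt0.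
have [m1 _ hm1] := cvgr_lt _ (@defect q) _ w0.
(* The two thresholds ensure m >= m1, for the cell averages, and n + k >= k >= e N >= n1, for
   tightness. *)
pose N0 := maxn 1 (maxn (Num.truncn ((m1%:R * eta) `^ alpha)).+1 (Num.truncn (n1%:R / e)).+1).
exists N0 => N n k; rewrite !geq_max => /and3P[N1 Nm Nn] nkN ek.
have NR0 : (0 : R) < N%:R by rewrite ltr0n.
set s : R := N%:R `^ alpha^-1.
have s0 : 0 < s by rewrite powR_gt0.
have s1 : 1 <= s.
  have N1R : (1 : R) <= N%:R by rewrite ler1n.
  have ai0 : 0 <= alpha^-1 by rewrite invr_ge0 ltW.
  by have := ler_powR N1R ai0; rewrite powRr0.
have sa : s `^ alpha = N%:R by rewrite /s -powRrM mulVf ?gt_eqF// powRr1// ltW.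
pose m := Num.truncn (s / eta).
have m1m : (m1 <= m)%N.
  rewrite /m -[m1](@natrK R) le_truncn// ler_pdivlMr//.
  rewrite leNgt; apply/negP => h.
  have : s `^ alpha < (m1%:R * eta) `^ alpha.
    by rewrite gt0_ltr_powR ?nnegrE ?mulr_ge0 ?(ltW s0) ?(ltW eta0).
  rewrite sa ltNge => /negP; apply.
  by rewrite (le_trans (ltW (truncnS_gt _)))// ler_nat.
have ms : s / eta < m.+1%:R by exact: truncnS_gt.
have mM : m.*2.+1%:R <= K * s.
  have hm : m%:R <= s / eta by rewrite truncn_le// divr_ge0 ?(ltW s0) ?(ltW eta0).
  have -> : m.*2.+1%:R = 2 * m%:R + 1 :> R by rewrite -natr1 -mul2n natrM.
  have -> : K * s = 2 * (s / eta) + s by rewrite /K; ring.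
  by rewrite lerD// ler_pM2l.
have k0 : (0 < k)%N by rewrite -(ltr0n R) (lt_le_trans _ ek)// mulr_gt0.
have n1nk : (n1 <= n + k)%N.
  rewrite (leq_trans _ (leq_addl n k))// -(ler_nat R) (le_trans _ ek)//.
  rewrite mulrC -ler_pdivrMr// (le_trans (ltW (truncnS_gt _)))// ler_nat//.
apply: (le_trans (covariance_bound n k m)).
have W0 : 0 <= cell_defect q m G.
  by rewrite mulr_ge0 ?invr_ge0// sumr_ge0.
have Wlt : cell_defect q m G < tau / 4 / (4 * B * S) := hm1 m m1m.
have h1 : \sum_(xi : {ffun 'I_d -> 'I_(m.*2.+1)})
    (`|fcoefc G xi| + `|fcoefs G xi|) *
    (2 * B * expR (- (c / 2 * k%:R * `|freq xi : 'rV[R]_d| `^ alpha))) <= tau / 2.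
  (* The 4 in both constants is 2, for the cosine and sine coefficients, times the 2 of
     [covariance_wave]. *)
  pose c1 : R := 4 * B ^+ 2 * pi / q.*2.+1%:R.
  pose c2 : R := 4 * B * cell_defect q m G.
  rewrite (@le_trans _ _ (\sum_(xi : {ffun 'I_d -> 'I_(m.*2.+1)})
      (c1 * norm1 xi + c2) * expR (- (kap * norm1 xi))))//.
    apply: ler_sum => xi _.
    have fw : kap * norm1 xi <= c / 2 * k%:R * `|freq xi : 'rV[R]_d| `^ alpha.
      exact: (freq_weight xi (ltW alpha_gt1) c20 K0 NR0 e0 mM ek).
    have hc := fcoef_bound q xi G_le (@norm_cos_le1 R) (@cos_lipschitz R).
    have hs := fcoef_bound q xi G_le (@norm_sin_le1 R) (@sin_lipschitz R).
    rewrite mulrA ler_pM ?expR_ge0 ?mulr_ge0 ?addr_ge0//; last by rewrite ler_expR lerN2.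
    rewrite (@le_trans _ _ (2 * (B * (pi * norm1 xi / q.*2.+1%:R) +
      cell_defect q m G) * (2 * B)))//.
      rewrite ler_wpM2r ?mulr_ge0// mulr2n mulrDl mul1r lerD//.
    by rewrite /c1 /c2 le_eqVlt; apply/orP; left; apply/eqP; ring.
  rewrite (le_trans (weighted_sum_bound _ _ _ kap0))//.
  - by rewrite divr_ge0// !mulr_ge0 ?sqr_ge0 ?pi_ge0.
  - by apply: mulr_ge0 => //; exact: mulr_ge0.
  rewrite -/S mulrDl (_ : tau / 2 = tau / 4 + tau / 4); last by field.
  rewrite lerD//.
    rewrite (_ : c1 * (2 / kap) * S = C / q.*2.+1%:R)//.
    by rewrite /c1 /C; ring.
  rewrite (_ : c2 * S = cell_defect q m G * (4 * B * S)); last by rewrite /c2; ring.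
  by rewrite -ler_pdivlMr ?ltW// !mulr_gt0.
have h2 : \int[P]_w Num.min 1 (m.+1%:R^-1 * `|toR (walk X (n + k) w) : 'rV[R]_d|)
    <= tau / (4 * B ^+ 2).
  apply: le_trans (ltW (hn1 _ n1nk)).
  have mt f : measurable_fun setT (fun w => f (walk X (n + k) w) : R).
    exact: (measurable_fun_walk X_iid).
  apply: le_mean => [||w].
  - apply: bmf_min1 => [|w]; last by rewrite mulr_ge0 ?invr_ge0.
    exact: (mt (fun x => m.+1%:R^-1 * `|toR x : 'rV[R]_d|)).
  - apply: bmf_min1 => [|w]; last by rewrite mulr_ge0 ?(ltW eta0).
    exact: (mt (fun x => eta * `|((n + k)%:R `^ alpha^-1)^-1 *: toR x : 'rV[R]_d|)).
  rewrite le_min !ge_min lexx/=; apply/orP; right.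
  have nk0 : (0 : R) < (n + k)%:R by rewrite ltr0n addn_gt0 k0 orbT.
  have t0 : 0 < (n + k)%:R `^ alpha^-1 :> R by rewrite powR_gt0.
  have ts : (n + k)%:R `^ alpha^-1 <= s.
    by rewrite /s ge0_ler_powR ?nnegrE ?invr_ge0 ?(ltW al0)// ler_nat.
  rewrite /scaled_walk normrZ ger0_norm ?invr_ge0 ?(ltW t0)// mulrA ler_wpM2r//.
  (* 1/(m+1) <= eta / s by the choice of m, and (n+k)^(1/alpha) <= s as n + k <= N. *)
  rewrite (@le_trans _ _ (eta / s))//.
    by rewrite -[leRHS]invrK invf_div lef_pV2 ?posrE ?divr_gt0 ?ltr0n// ltW.
  by rewrite ler_wpM2l ?(ltW eta0)// lef_pV2 ?posrE.
rewrite (_ : tau = tau / 2 + 2 * B ^+ 2 * (tau / (4 * B ^+ 2))); last first.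
  by field; rewrite gt_eqF.
rewrite lerD// ler_wpM2l// mulr_ge0 ?sqr_ge0//.
Qed.

End covariance.

(** * From covariances to convergence in law *)

Lemma count_near_diagonal (n h a b : nat) :
  (count (fun k => (k < n + h) && (n < k + h)) (index_iota a b) <= h.*2)%N.
Proof.
rewrite -size_filter -[leqRHS](size_iota (n - h)).
(* If n < h the window starts at the truncated difference 0, and its length 2h still reaches n +
   h. *)
apply: uniq_leq_size; first by rewrite filter_uniq// iota_uniq.
move=> k; rewrite mem_filter mem_iota => /andP[/andP[h1 h2] _].
by apply/andP; split; lia.
Qed.

Section second_moment.
Context {R : realType} {disp : measure_display} {T : measurableType disp}.
Variable P : probability T R.

(** Pairs of times less than h apart are few and bounded by B^2; the others have covariance at most
    [tau], after ordering the two times. *)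
Lemma second_moment_le (f : nat -> T -> R) (B tau : R) (N h : nat) :
  0 <= tau -> (forall n, bmf (f n)) -> (forall n w, `|f n w| <= B) ->
  (forall n k, (n + k <= N)%N -> (h <= k)%N ->
    `|\int[P]_w (f n w * f (n + k)%N w)| <= tau) ->
  \int[P]_w ((\sum_(1 <= n < N.+1) f n w) ^+ 2) <=
  N%:R ^+ 2 * tau + 2 * N%:R * h%:R * B ^+ 2.
Proof.
move=> tau0 bf fB cov.
have bff n k : bmf (fun w => f n w * f k w) by exact: bmfM.
have -> : \int[P]_w ((\sum_(1 <= n < N.+1) f n w) ^+ 2) =
  \sum_(1 <= n < N.+1) \sum_(1 <= k < N.+1) \int[P]_w (f n w * f k w).
  under [RHS]eq_bigr => n _ do rewrite -mean_sum//.
  rewrite -mean_sum; last by move=> n; apply: bmf_sum.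
  apply: eq_Rintegral => w _; rewrite expr2 mulr_suml.
  by apply: eq_bigr => n _; rewrite mulr_sumr.
pose near n k := (k < n + h)%N && (n < k + h)%N.
have term n k : (n <= N)%N -> (k <= N)%N ->
    \int[P]_w (f n w * f k w) <= tau + B ^+ 2 * (near n k)%:R.
  move=> nN kN; have [nr|nr] := boolP (near n k).
    rewrite mulr1 ler_wpDl//; apply: (le_trans (ler_norm _)).
    by apply: norm_mean_le => // w; rewrite normrM expr2 ler_pM.
  rewrite mulr0 addr0; apply: (le_trans (ler_norm _)).
  move: nr; rewrite negb_and -!leqNgt => /orP[nk|kn].
    have E : k = (n + (k - n))%N by lia.
    rewrite E; apply: cov; lia.
  have E : n = (k + (n - k))%N by lia.
  rewrite (@eq_Rintegral _ _ _ P _ (fun w => f k w * f n w)); last by move=> w _; rewrite mulrC.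
  rewrite E; apply: cov; lia.
rewrite (@le_trans _ _ (\sum_(1 <= n < N.+1) (N%:R * tau + B ^+ 2 * (2 * h%:R))))//; last first.
  rewrite sumr_const_nat subn1 /= -mulr_natl.
  by rewrite le_eqVlt; apply/orP; left; apply/eqP; ring.
rewrite big_nat [leRHS]big_nat; apply: ler_sum => n /andP[_ nN].
rewrite (@le_trans _ _ (\sum_(1 <= k < N.+1) (tau + B ^+ 2 * (near n k)%:R)))//.
  rewrite big_nat [leRHS]big_nat; apply: ler_sum => k /andP[_ kN].
  by apply: term; rewrite -ltnS.
rewrite big_split /= sumr_const_nat subn1 /= -[X in X + _]mulr_natl lerD2l.
rewrite -mulr_sumr ler_wpM2l ?sqr_ge0//.
rewrite -natr_sum -natrM ler_nat mul2n.
apply: leq_trans (count_near_diagonal n h 1 N.+1).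
by rewrite -sum1_count [leqRHS]big_mkcond leq_sum// => k _; case: (near n k).
Qed.

(** Chebyshev's inequality in pointwise form: |f z - f y| <= e/2 + A (y - z)^2, by continuity of [f]
    within distance r of z and by boundedness beyond, with A = 2M / r^2. *)
Lemma concentration_cvg_in_law (Z : nat -> T -> R) (z : R) :
  (forall n, bmf (Z n)) ->
  (fun n => \int[P]_w ((Z n w - z) ^+ 2)) @ \oo --> (0 : R) ->
  cvg_in_law P Z (dirac (z : borel R)).
Proof.
move=> bZ hZ f cf [M fM].
have mf : measurable_fun setT (f : borel R -> R) := continuous_borel cf.
have -> : (\int[(dirac (z : borel R) : probability (borel R) R)]_y (f y)%:E = (f z)%:E)%E.
  rewrite integral_dirac//; last exact/measurable_EFinP.
  by rewrite diracT mul1e.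
have bfZ n : bmf (fun w => f (Z n w)).
  split; last by exists M.
  by apply: measurableT_comp (bZ n).1; exact: continuous_measurable_fun.
rewrite (_ : (fun n => _) = (fun n => (\int[P]_w f (Z n w))%:E)); last first.
  by apply/funext => n; rewrite -bmf_expectation.
apply: cvg_EFin; first exact: nearW.
apply/cvgrPdist_le => e e0 /=.
have e20 : 0 < e / 2 by rewrite divr_gt0.
have /cvgrPdist_lt/(_ _ e20)/nbhs_ballP[r /= r0 hr] := cf z.
have M0 : 0 <= M by exact: le_trans (fM z).
pose A := 2 * M / r ^+ 2.
have A0 : 0 <= A by rewrite divr_ge0 ?sqr_ge0// mulr_ge0.
have pt y : `|f z - f y| <= e / 2 + A * (y - z) ^+ 2.
  have [yz|yz] := ltP `|z - y| r.
    have hy : `|f z - f y| < e / 2 by apply: hr; rewrite -ball_normE.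
    by rewrite ler_wpDr ?(ltW hy)// mulr_ge0// sqr_ge0.
  rewrite ler_wpDl ?(ltW e20)//.
  apply: (@le_trans _ _ (2 * M)).
    by rewrite (le_trans (ler_normB _ _))// mulr2n mulrDl mul1r lerD.
  rewrite /A -[X in _ <= X]mulrA ler_peMr ?mulr_ge0// ler_pdivlMl ?exprn_gt0// mulr1.
  rewrite -[leRHS]real_normK ?num_real// distrC ler_pXn2r ?nnegrE//.
  exact: ltW.
(* [A] may vanish, hence A + 1. *)
have A10 : 0 < e / 2 / (A + 1) by rewrite divr_gt0// ltr_wpDl.
have [n0 _ hn0] := cvgr_lt _ hZ _ A10.
exists n0 => // n n0n.
have bsq : bmf (fun w => (Z n w - z) ^+ 2).
  by apply: bmfX; apply: bmfB => //; exact: bmf_cst.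
have -> : f z - \int[P]_w f (Z n w) = \int[P]_w (f z - f (Z n w)).
  by rewrite meanB ?mean_cst//; exact: bmf_cst.
have bd : bmf (fun w => f z - f (Z n w)) by apply: bmfB => //; exact: bmf_cst.
apply: (le_trans (le_norm_mean P bd)).
apply: (@le_trans _ _ (\int[P]_w (e / 2 + A * (Z n w - z) ^+ 2))).
  apply: le_mean => //; first exact: bmf_norm.
  by apply: bmfD; [exact: bmf_cst|exact: bmfZ].
rewrite meanD; [|exact: bmf_cst|exact: bmfZ].
rewrite mean_cst meanZ// [leRHS](_ : e = e / 2 + e / 2); last by field.
rewrite lerD2l.
have := hn0 n n0n; rewrite ltr_pdivlMr ?ltr_wpDl// => h.
apply: le_trans (ltW h); rewrite mulrC ler_wpM2l ?lerDl//.
by apply: mean_ge0 => w; exact: sqr_ge0.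
Qed.

End second_moment.

Theorem theorem1p1 (R : realType) (d : nat) (d_gt0 : (0 < d)%N)
  (disp : measure_display) (Omega : measurableType disp)
  (P : probability Omega R) (X : nat -> Omega -> 'rV[int]_d)
  (X_iid : iid P X)
  (X_nondegenerate : nondegenerate_walk P X)
  (X_aperiodic : aperiodic_walk P X)
  (X_integrable : integrable_step P X)
  (X_centered : mean_step P X = 0)
  (alpha : R) (alpha_gt1 : 1 < alpha) (alpha_le2 : alpha <= 2)
  (X_attracted : in_normal_domain_of_attraction P X alpha)
  (F : 'rV[int]_d -> R) (F_G0 : G0 F)
  (Fbar : R) (F_average : global_average F Fbar) :
  cvg_in_law P
    (fun N w => (N%:R)^-1 * \sum_(1 <= n < N.+1) F (walk X n w) : R)
    (dirac (Fbar : borel R)).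
Proof.
have [mu [mu_nd mu_st mu_cv]] := X_attracted.
have [[M FM] _] := F_G0.
have [c c0 decay] := rho_decay X_iid X_centered alpha_gt1 mu_nd mu_st mu_cv
  X_nondegenerate X_aperiodic.
pose G x := F x - Fbar.
pose B := M + `|Fbar| + 1.
have M0 : 0 <= M by exact: le_trans (FM 0).
have B0 : 0 < B by rewrite ltr_wpDl// addr_ge0.
have GB x : `|G x| <= B.
  by rewrite (le_trans (ler_normB _ _))// ler_wpDr// lerD.
have bF n : bmf (fun w => F (walk X n w)) := bmf_walk X_iid n FM.
have bG n : bmf (fun w => G (walk X n w)) := bmf_walk X_iid n GB.
have tight := scaled_walk_tight X_iid X_centered mu_cv.
have small := covariance_small X_iid alpha_gt1 c0 decay B0 GB tight
  (fun q => cell_defect_cvg q F_average).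
apply: concentration_cvg_in_law => [n|].
  by apply: bmfZ; exact: bmf_sum.
apply/cvgrPdist_le => e e0 /=.
(* Distant pairs contribute N^2 e/2. Near pairs contribute 2 N h B^2 with h <= eps N + 1, that is
   N^2 e/4 + 2 N B^2, and the last term is at most N^2 e/4 once N >= 8 B^2 / e. *)
have eps0 : 0 < e / (8 * B ^+ 2) by rewrite divr_gt0// mulr_gt0// exprn_gt0.
have [N0 hN0] := small (e / 2) (e / (8 * B ^+ 2)) (divr_gt0 e0 (ltr0n _ 2)) eps0.
exists (maxn N0 (maxn 1 (Num.truncn (8 * B ^+ 2 / e)).+1)) => // N /=.
rewrite !geq_max => /and3P[N0N N1 Ne].
have NR0 : (0 : R) < N%:R by rewrite ltr0n.
rewrite sub0r normrN ger0_norm; last by apply: mean_ge0 => w; exact: sqr_ge0.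
have -> : \int[P]_w ((N%:R^-1 * \sum_(1 <= n < N.+1) F (walk X n w) - Fbar) ^+ 2) =
    N%:R^-1 ^+ 2 * \int[P]_w ((\sum_(1 <= n < N.+1) G (walk X n w)) ^+ 2).
  rewrite -meanZ; last by apply: bmfX; exact: bmf_sum.
  apply: eq_Rintegral => w _; rewrite -exprMn; congr (_ ^+ 2).
  rewrite /G sumrB sumr_const_nat subn1 /= -[X in _ = _ * (_ - X)]mulr_natl mulrBr.
  by rewrite [in RHS]mulrA mulVf ?mul1r// gt_eqF.
pose h := (Num.truncn (e / (8 * B ^+ 2) * N%:R)).+1.
have hle : h%:R <= e / (8 * B ^+ 2) * N%:R + 1.
  by rewrite /h -natr1 lerD2r truncn_le// mulr_ge0// ltW.
have cov n k : (n + k <= N)%N -> (h <= k)%N ->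
    `|\int[P]_w (G (walk X n w) * G (walk X (n + k) w))| <= e / 2.
  move=> nkN hk; apply: (hN0 N) => //.
  by rewrite (le_trans (ltW (truncnS_gt _)))// ler_nat.
rewrite exprVn ler_pdivrMl ?exprn_gt0//.
apply: (le_trans (@second_moment_le _ _ _ P (fun n w => G (walk X n w)) B (e / 2) N h
  (ltW (divr_gt0 e0 (ltr0n _ 2))) bG (fun n w => GB _) cov)).
have B20 : 0 < B ^+ 2 by rewrite exprn_gt0.
have hN : 8 * B ^+ 2 <= e * N%:R.
  by rewrite [leRHS]mulrC -ler_pdivrMr// (le_trans (ltW (truncnS_gt _)))// ler_nat.
rewrite (@le_trans _ _ (N%:R ^+ 2 * (e / 2) + 2 * N%:R * (e / (8 * B ^+ 2) * N%:R + 1) * B ^+ 2))//.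
  by rewrite lerD2l ler_wpM2r ?(ltW B20)// ler_wpM2l// mulr_ge0.
have -> : 2 * N%:R * (e / (8 * B ^+ 2) * N%:R + 1) * B ^+ 2 =
   N%:R ^+ 2 * (e / 4) + N%:R * (2 * B ^+ 2).
  by field; rewrite gt_eqF.
rewrite (_ : _ ^+ 2 * e = N%:R ^+ 2 * (e / 2) +
  (N%:R ^+ 2 * (e / 4) + N%:R * (N%:R * e / 4))); last by field.
rewrite !lerD2l ler_wpM2l//; move: hN; set x := B ^+ 2; lra.
Qed.
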